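(* Let $a,c$ be nonzero complex numbers, let $\ell,m$ be nonnegative integers and let $n$ be a nonnegative integer. Then $$ {}_4\phi_3\left[\begin{matrix}q^{-n},\,q^{1+\ell+n}a,\,\sqrt{c},\,-q^{m}\sqrt{c}\\ q\sqrt{a},\,-q^{1+\ell}\sqrt{a},\,q^{m}c\end{matrix};q,q\right] =\frac{(q^{1+\ell+n}a,\,q^{1+n}\sqrt{a};q)_\ell}{(q^{1+\ell+2n}a,\,q\sqrt{a};q)_\ell} \sum_{i=0}^{\ell}\sum_{j=0}^{m}T_{i,j}, $$ where $$ T_{i,j}=q^{2i+(m+n-i)j-\binom{j}{2}}\,\frac{c^{(n-i)/2}}{a^{i/2}}\,\frac{1-q^{1+2\ell+2n-2i}a}{1-q^{1+2\ell+2n}a}\, \frac{(q^{-\ell},q^{-n},q^{-2\ell-2n-1}/a;q)_i}{(q,\,q^{-\ell-2n}/a,\,q^{-2\ell-n}/a;q)_i} $$ $$ \times\frac{(q^{-m},q^{i-n},q^{1+2\ell+n-i}a,\sqrt{c},-\sqrt{c};q)_j}{(q,\,q^{1+\ell}\sqrt{a},\,-q^{1+\ell}\sqrt{a},\,q^{m}c,\,q^{j-1}c;q)_j}\, \frac{(q,\,q^{2+2\ell}a/c;q^2)_{(n-i-j)/2}}{(q^{2+2\ell+2j}a,\,q^{1+2j}c;q^2)_{(n-i-j)/2}}\,\chi(n-i-j). $$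
   Context: $q$ is a nonzero complex number. For complex $x$ and an integer $n\ge 0$, the $q$-shifted factorial is $(x;q)_0=1$, $(x;q)_n=\prod_{k=0}^{n-1}(1-xq^k)$, and $(x_1,\dots,x_r;q)_n=\prod_{s=1}^r (x_s;q)_n$ (likewise with base $q^2$ in place of $q$). The basic hypergeometric series is ${}_4\phi_3\left[\begin{matrix}a_0,a_1,a_2,a_3\\ b_1,b_2,b_3\end{matrix};q,z\right]=\sum_{k\ge0}\frac{(a_0,a_1,a_2,a_3;q)_k}{(q,b_1,b_2,b_3;q)_k}z^k$. Here one upper parameter is $q^{-n}$, so the series terminates and means the sum over $0\le k\le n$. Parameters are assumed to be such that no zero factor appears in a denominator of the displayed expressions. Put $\chi(k)=\{1+(-1)^k\}/2$. A term with $i+j>n$ contains the vanishing factor $(q^{-n};q)_i(q^{i-n};q)_j$ and is read as $0$; terms with $\chi(n-i-j)=0$ are also read as $0$. $\sqrt a,\sqrt c$ are fixed square roots, and $a^{i/2}=(\sqrt a)^i$, $c^{k/2}=(\sqrt c)^k$. *)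

(* Defs.v *)
(* MathComp *)
From mathcomp Require Import all_boot all_order all_algebra.
From mathcomp Require Import reals complex.
Set Implicit Arguments.
Unset Strict Implicit.
Unset Printing Implicit Defensive.
Import GRing.Theory.
Local Open Scope ring_scope.

(* (x; q)_n *)
Definition qpoch (F : fieldType) (x q : F) (n : nat) : F :=
  \prod_(k < n) (1 - x * q ^+ k).

(* (x_1, ..., x_r; q)_n *)
Definition qpochs (F : fieldType) (xs : seq F) (q : F) (n : nat) : F :=
  \prod_(x <- xs) qpoch x q n.

(* The 4phi3 series summed over 0 <= k <= n; this is the whole series when one
   of the upper parameters is q^{-n}. *)
Definition phi43 (F : fieldType) (n : nat)
    (a0 a1 a2 a3 b1 b2 b3 q z : F) : F :=
  \sum_(k < n.+1)
    qpochs [:: a0; a1; a2; a3] q k / qpochs [:: q; b1; b2; b3] q k * z ^+ k.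

Definition chi (F : fieldType) (k : nat) : F := (1 + (-1) ^+ k) / 2.

(* In [T] and [T_den], [sa] and [sc] are the fixed square roots of [a] and [c],
   and (q ^ z) is the power with integer exponent z. *)
Definition T (F : fieldType) (q a c sa sc : F) (l m n i j : nat) : F :=
  if (i + j <= n)%N then
    q ^ ((2 * i)%N%:Z + (m%:Z + n%:Z - i%:Z) * j%:Z - 'C(j, 2)%:Z)
    * (sc ^+ (n - i) / sa ^+ i)
    * ((1 - q ^ (1 + 2 * l%:Z + 2 * n%:Z - 2 * i%:Z) * a)
       / (1 - q ^+ (1 + 2 * l + 2 * n) * a))
    * (qpochs [:: q ^ (- l%:Z); q ^ (- n%:Z);
                  q ^ (- 2 * l%:Z - 2 * n%:Z - 1) / a] q i
       / qpochs [:: q; q ^ (- l%:Z - 2 * n%:Z) / a;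
                    q ^ (- 2 * l%:Z - n%:Z) / a] q i)
    * (qpochs [:: q ^ (- m%:Z); q ^ (i%:Z - n%:Z);
                  q ^ (1 + 2 * l%:Z + n%:Z - i%:Z) * a; sc; - sc] q j
       / qpochs [:: q; q ^+ (1 + l) * sa; - (q ^+ (1 + l) * sa);
                    q ^+ m * c; q ^ (j%:Z - 1) * c] q j)
    * (qpochs [:: q; q ^+ (2 + 2 * l) * a / c] (q ^+ 2) (n - i - j)./2
       / qpochs [:: q ^+ (2 + 2 * l + 2 * j) * a; q ^+ (1 + 2 * j) * c]
           (q ^+ 2) (n - i - j)./2)
    * chi F (n - i - j)
  else 0.

(* The product of the q-dependent denominators of the expression in [T]; the
   other divisors, sa ^+ i, a and c, are nonzero when a and c are. *)
Definition T_den (F : fieldType) (q a c sa : F) (l m n i j : nat) : F :=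
  (1 - q ^+ (1 + 2 * l + 2 * n) * a)
  * qpochs [:: q; q ^ (- l%:Z - 2 * n%:Z) / a;
               q ^ (- 2 * l%:Z - n%:Z) / a] q i
  * qpochs [:: q; q ^+ (1 + l) * sa; - (q ^+ (1 + l) * sa);
               q ^+ m * c; q ^ (j%:Z - 1) * c] q j
  * qpochs [:: q ^+ (2 + 2 * l + 2 * j) * a; q ^+ (1 + 2 * j) * c]
      (q ^+ 2) (n - i - j)./2.

(* Main.v *)
Require Import Defs.
From mathcomp Require Import all_boot all_order all_algebra.
From mathcomp Require Import reals complex.
From mathcomp Require Import ring zify.
Set Implicit Arguments.
Unset Strict Implicit.
Unset Printing Implicit Defensive.
Import GRing.Theory.
Local Open Scope ring_scope.

(** Everything reduces to the terminating very-well-poised 6phi5 sum, used three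
    times.  With A = c/q, b = -sqrt c and terminator q^-k it expands
    (-q^m sqrt c; q)_k / (q^m c; q)_k so that the j-th term carries the case m = 0
    with (a, c) replaced by (q^(2j) a, q^(2j) c).  With A = q^(-2l-2n-1)/a it expands
    (q^-n, q^(1+l+n) a; q)_k / (q sqrt a; q)_k into terms where n becomes n-i and a
    becomes q^(2l) a.  The remaining case l = m = 0 is Andrews' terminating q-Watson
    sum: in base q^2, with terminating parameters q^-k and q^(1-k), the 6phi5 sum is
    one half of an inverse pair whose other half is the q-Watson sum.

    These expansions divide by factors 1 - q^e a and 1 - q^e c that may vanish for
    the given parameters.  The identity is therefore proved over F(X) with sqrt a
    and sqrt c replaced by X + sqrt a and X + sqrt c, where no such factor is zero,
    and then evaluated at X = 0, where the identity itself has no zero denominator. *)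

(** * Elementary identities for q-shifted factorials *)

Section QPochhammer.
Variable (F : fieldType).
Implicit Types (x q : F).

Lemma qpoch0 x q : qpoch x q 0 = 1.
Proof. exact: big_ord0. Qed.

Lemma qpochS x q n : qpoch x q n.+1 = qpoch x q n * (1 - x * q ^+ n).
Proof. exact: big_ord_recr. Qed.

Lemma qpochD x q m n : qpoch x q (m + n) = qpoch x q m * qpoch (x * q ^+ m) q n.
Proof.
elim: n => [|n IHn]; first by rewrite addn0 qpoch0 mulr1.
by rewrite addnS !qpochS IHn -!mulrA -exprD.
Qed.

Lemma qpochSl x q n : qpoch x q n.+1 = (1 - x) * qpoch (x * q) q n.
Proof. by rewrite -add1n qpochD qpochS qpoch0 mul1r expr0 mulr1 expr1. Qed.

Lemma qpoch_neq0 x q n :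
  (forall k, (k < n)%N -> 1 - x * q ^+ k != 0) -> qpoch x q n != 0.
Proof. by move=> h; apply/prodf_neq0 => k _; apply: h. Qed.

Lemma qpoch_eq0 x q n k : (k < n)%N -> x * q ^+ k = 1 -> qpoch x q n = 0.
Proof.
move=> kn xk; apply/eqP/prodf_eq0; exists (Ordinal kn) => //=.
by rewrite xk subrr.
Qed.

Lemma qpochN x q n : qpoch x q n * qpoch (- x) q n = qpoch (x ^+ 2) (q ^+ 2) n.
Proof.
rewrite /qpoch -big_split; apply: eq_bigr => k _ /=.
by rewrite [X in _ = 1 - _ * X]exprAC; ring.
Qed.

Lemma qpoch_double x q n :
  qpoch x q n.*2 = qpoch x (q ^+ 2) n * qpoch (x * q) (q ^+ 2) n.
Proof.
elim: n => [|n IHn]; first by rewrite !qpoch0 mulr1.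
by rewrite doubleS !qpochS IHn -!exprM mul2n [q ^+ n.*2.+1]exprS; ring.
Qed.

(** Reversing the product turns its factors into 1 - 1/(x q^k) = -x^-1 q^-k (1 - x q^k). The
    predecessor is harmless at n = 0, where both sides are 1. *)
Lemma qpoch_inv x q n : x != 0 -> q != 0 ->
  qpoch (x * q ^+ n.-1)^-1 q n = (- x^-1) ^+ n * (q ^+ 'C(n, 2))^-1 * qpoch x q n.
Proof.
move=> x0 q0; case: n => [|n]; first by rewrite !qpoch0 bin0n expr0 invr1 !mulr1.
elim: n => [|n IHn] /=.
  by rewrite !qpochS !qpoch0 bin_small //= !expr0 expr1; field; rewrite oner_neq0 x0.
rewrite /= in IHn; rewrite qpochSl.
have -> : (x * q ^+ n.+1)^-1 * q = (x * q ^+ n)^-1.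
  by rewrite exprS; field; rewrite q0 x0 expf_neq0.
rewrite IHn [qpoch x q n.+2]qpochS [(- x^-1) ^+ n.+2]exprS ['C(n.+2, 2)]binS bin1 exprD.
by field; rewrite x0 !expf_neq0.
Qed.

End QPochhammer.

(** * The terminating very-well-poised 6phi5 sum *)

Section Phi65.
Variables (F : fieldType) (q A b c : F).
Hypotheses (q0 : q != 0) (b0 : b != 0) (c0 : c != 0).
Hypothesis hA : forall k, 1 - A * q ^+ k != 0.
Hypothesis hb : forall k, 1 - A * q / b * q ^+ k != 0.
Hypothesis hc : forall k, 1 - A * q / c * q ^+ k != 0.

(* D N k = q^(N k) (q^-N; q)_k *)
Let D N k := \prod_(s < k) (q ^+ N - q ^+ s).

(** [w] collects what is free of N in the 6phi5 summand, and [t] is the whole summand: the power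
    q^(N k) of its argument is absorbed in [D]. *)
Let w k := (1 - A * q ^+ k.*2) / (1 - A) * qpochs [:: A; b; c] q k
   / qpochs [:: q; A * q / b; A * q / c] q k * (A * q / (b * c)) ^+ k.

Let t N k := w k * D N k / qpoch (A * q ^+ N.+1) q k.

(* The WZ certificate: multiplying the sum over N by its expected denominators, the
   first-order recurrence in N telescopes in k through g. *)
Let g N k := q ^+ N * (1 - A * q ^+ N.+1) * qpoch (A * q) q k * qpoch b q k.+1
  * qpoch c q k.+1 / (qpochs [:: q; A * q / b; A * q / c] q k)
  * (A * q / (b * c)) ^+ k.+1 * D N k / qpoch (A * q ^+ N.+1) q k.+1.

Let DS N k : D N k.+1 = D N k * (q ^+ N - q ^+ k).
Proof. exact: big_ord_recr. Qed.

(** The factor s = 0 is q^(N+1) - 1, and each later one is q (q^N - q^(s-1)). *)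
Let DSS N k : D N.+1 k.+1 = (q ^+ N.+1 - 1) * q ^+ k * D N k.
Proof.
elim: k => [|k IHk]; first by rewrite DS /D !big_ord0 !expr0; ring.
by rewrite DS IHk DS !exprS; ring.
Qed.

Let telescope N K : (K <= N.+1)%N -> qpoch q q K != 0 ->
  \sum_(k < K.+1) ((1 - A * q / b * q ^+ N) * (1 - A * q / c * q ^+ N) * t N.+1 k
     - (1 - A * q ^+ N.+1) * (1 - A * q / (b * c) * q ^+ N) * t N k) = g N K.
Proof.
have A1 : 1 - A != 0 by have := hA 0; rewrite mulr1.
have hA' k : 1 - A * q * q ^+ k != 0 by have := hA k.+1; rewrite exprS mulrA.
have hAN k : 1 - A * q ^+ N.+1 * q ^+ k != 0 by rewrite -mulrA -exprD.
have pA n : qpoch (A * q ^+ N.+1) q n != 0 by apply: qpoch_neq0 => k _.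
have pb n : qpoch (A * q / b) q n != 0 by apply: qpoch_neq0 => k _.
have pc n : qpoch (A * q / c) q n != 0 by apply: qpoch_neq0 => k _.
elim: K => [|K IHK] KN hq.
  rewrite big_ord_recr big_ord0 /= add0r /g /t /w /D !big_ord0 /qpochs.
  rewrite !big_cons !big_nil !qpochS !qpoch0 !expr0 !expr1 !mulr1 !exprS.
  have := hAN 0; have := hA N.+1; rewrite exprS expr0 mulr1 => h1 h2; field.
  by rewrite c0 b0 h1 oner_neq0.
rewrite big_ord_recr /= IHK //; first last.
- by move: hq; rewrite qpochS mulf_eq0 negb_or; case/andP.
- by rewrite ltnW.
move: hq; rewrite qpochS mulf_eq0 negb_or -exprS => /andP[hqK hqS].
rewrite /t DSS /g /w /qpochs !big_cons !big_nil !mulr1.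
(* The factorials are reduced to common arguments and lengths, so that the step from g N K to g N
   (K+1) becomes a rational-function identity for [field]. *)
have -> : qpoch (A * q ^+ N.+2) q K.+1 = qpoch (A * q ^+ N.+1) q K.+2 / (1 - A * q ^+ N.+1).
  by rewrite [qpoch _ _ K.+2]qpochSl -mulrA -exprSr [_ * qpoch _ _ _]mulrC mulfK.
have -> : qpoch A q K.+1 = (1 - A) * qpoch (A * q) q K by rewrite qpochSl.
have -> : q ^+ K.+1.*2 = q ^+ 2 * (q ^+ K) ^+ 2.
  by rewrite -muln2 mulSn exprD exprM.
rewrite DS !qpochS.
have hbK : b - A * q * q ^+ K != 0.
  have -> : b - A * q * q ^+ K = b * (1 - A * q / b * q ^+ K) by field.
  by rewrite mulf_neq0.
have hcK : c - A * q * q ^+ K != 0.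
  have -> : c - A * q * q ^+ K = c * (1 - A * q / c * q ^+ K) by field.
  by rewrite mulf_neq0.
move: (hAN K.+1) (hAN K) (hA N.+1) (pA K) hqS; rewrite !exprS.
by move=> h1 h2 h3 h4 h5; field; rewrite h1 h2 h3 h4 h5 c0 b0 hcK hbK pb pc hqK A1.
Qed.

(** At K = N+1 the factor D N (N+1) = 0 kills the certificate and the surplus term of the sum S_N,
    so telescoping gives S_(N+1) (1 - A q^(N+1)/b) (1 - A q^(N+1)/c) = S_N (1 - A q^(N+1)) (1 - A
    q^(N+1)/(b c)). Induction on N solves this recurrence. *)
Lemma phi65_sum N : qpoch q q N != 0 ->
  \sum_(k < N.+1) (1 - A * q ^+ k.*2) / (1 - A)
     * qpochs [:: A; b; c; (q ^+ N)^-1] q k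
     / qpochs [:: q; A * q / b; A * q / c; A * q ^+ N.+1] q k
     * (A * q ^+ N.+1 / (b * c)) ^+ k
  = qpochs [:: A * q; A * q / (b * c)] q N / qpochs [:: A * q / b; A * q / c] q N.
Proof.
move=> hq.
have pA k : qpoch (A * q ^+ N.+1) q k != 0.
  by apply: qpoch_neq0 => s _; rewrite -mulrA -exprD.
have pb k : qpoch (A * q / b) q k != 0 by apply: qpoch_neq0 => s _.
have pc k : qpoch (A * q / c) q k != 0 by apply: qpoch_neq0 => s _.
have DE k : D N k = (q ^+ N) ^+ k * qpoch (q ^+ N)^-1 q k.
  elim: k => [|k IHk]; first by rewrite /D big_ord0 qpoch0 mulr1.
  rewrite DS IHk qpochS exprS; field.
  by rewrite expf_neq0.
transitivity (\sum_(k < N.+1) t N k).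
  apply: eq_bigr => k _; rewrite /t /w DE /qpochs !big_cons !big_nil !mulr1.
  have -> : A * q ^+ N.+1 / (b * c) = A * q / (b * c) * q ^+ N by rewrite exprS; ring.
  by rewrite exprMn !invfM; ring.
have D0 M : D M M.+1 = 0 by rewrite DS subrr mulr0.
suff E : (\sum_(k < N.+1) t N k) * qpochs [:: A * q / b; A * q / c] q N
         = qpochs [:: A * q; A * q / (b * c)] q N.
  by rewrite -E mulfK // /qpochs !big_cons big_nil mulr1 mulf_neq0.
rewrite /qpochs !big_cons !big_nil !mulr1.
elim: N hq {pA DE} => [|N IHN] hq.
  rewrite big_ord_recr big_ord0 /= /t /w /D big_ord0 /qpochs !big_cons !big_nil.
  have A1 : 1 - A != 0 by have := hA 0; rewrite mulr1.
  by rewrite !qpoch0 !expr0 !mulr1 invr1 divff // !mulr1 add0r.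
have hqN : qpoch q q N != 0.
  by move: hq; rewrite qpochS mulf_eq0 negb_or; case/andP.
have := telescope (leqnn N.+1) hq.
rewrite big_split /= sumrN -!mulr_sumr [\sum_(k < N.+2) t N k]big_ord_recr /=.
rewrite {3}/t /g D0 !mulr0 !mul0r addr0 => /eqP; rewrite subr_eq0 => /eqP E.
rewrite !qpochS.
have -> (S x1 y1 x2 y2 : F) : S * (x1 * y1 * (x2 * y2)) = y1 * y2 * S * (x1 * x2) by ring.
rewrite E -mulrA IHN //.
by rewrite exprS; ring.
Qed.
End Phi65.

(** * Inversion formulas and the passage to base q^2 *)

Section Inversion.
Variable (F : fieldType).
Implicit Types (x y q : F).

Lemma qpoch_neq0_le x q m n : (m <= n)%N -> qpoch x q n != 0 -> qpoch x q m != 0.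
Proof. by move=> /subnKC<-; rewrite qpochD mulf_eq0 negb_or => /andP[]. Qed.

(** Each new factor 1 - q^(j-k) equals -q^(j-k) (1 - q^(k-j)), and 1 - q^(k-j) is the factor lost
    when (q; q)_(k-j) becomes (q; q)_(k-j-1). The form without division also covers (q; q)_k = 0. *)
Lemma qpoch_inv_q q k j : q != 0 -> (j <= k)%N ->
  qpoch (q ^+ k)^-1 q j * qpoch q q (k - j) * q ^+ (k * j)
  = (-1) ^+ j * q ^+ 'C(j, 2) * qpoch q q k.
Proof.
move=> q0; elim: j => [|j IHj] jk; first by rewrite qpoch0 muln0 subn0 bin0n expr0; ring.
have kj : (k - j)%N = (k - j.+1).+1 by lia.
move: (IHj (ltnW jk)); rewrite kj qpochS => E.
have qk : q ^+ k = q ^+ j * q ^+ (k - j.+1) * q.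
  by rewrite -exprD -exprSr; congr (_ ^+ _); lia.
rewrite qpochS mulnS exprD binS bin1 exprD exprS.
have -> (s b w p : F) : -1 * s * (b * w) * p = - w * (s * b * p) by ring.
by rewrite -E qk; field; rewrite q0 !expf_neq0.
Qed.

(* For y = q^-K the right-hand side vanishes unless K = 0. *)
Lemma qpoch_partial_sum q x y K : y != 0 -> qpoch q q K != 0 ->
  (forall k, 1 - x * q * q ^+ k != 0) ->
  \sum_(k < K.+1) qpochs [:: y; x / y] q k / qpochs [:: q; x * q] q k * q ^+ k
  = qpochs [:: y * q; x * q / y] q K / qpochs [:: q; x * q] q K.
Proof.
move=> y0 hq hx; have px k : qpoch (x * q) q k != 0 by apply: qpoch_neq0.
rewrite /qpochs; elim: K hq => [|K IHK] hq.
  by rewrite big_ord_recr big_ord0 /= add0r !big_cons !big_nil !qpoch0 expr0 !mulr1.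
move: hq; rewrite qpochS mulf_eq0 negb_or => /andP[hqK hqS].
rewrite big_ord_recr /= IHK // !big_cons !big_nil !mulr1.
rewrite [qpoch y q _]qpochSl [qpoch (x / y) q _]qpochSl.
rewrite [x / y * q]mulrAC !qpochS; move: (hx K) hqS; rewrite exprS => h1 h2.
by field; rewrite h1 h2 px hqK y0.
Qed.

(** Put k = o + 2N. Split (x; q)_k into even and odd exponents, and (x; q^2)_k after its first N + o
    factors: in both parities the remaining N factors start at exponent k + o. *)
Lemma qpoch_sqr_base q x (o : bool) N :
  qpoch x (q ^+ 2) (o + N * 2) * qpoch (x * q) (q ^+ 2) N
  = qpoch x q (o + N * 2) * qpoch (x * q ^+ (o + N * 2 + o)) (q ^+ 2) N.
Proof.
case: o; last first.
  rewrite add0n addn0 [in qpoch x q _]muln2 qpoch_double muln2 -addnn qpochD.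
  by rewrite -exprM mul2n addnn; ring.
rewrite add1n addn1.
have -> : qpoch x (q ^+ 2) (N * 2).+1 = qpoch x (q ^+ 2) N * (1 - x * q ^+ (N * 2))
            * qpoch (x * q ^+ (N * 2).+2) (q ^+ 2) N.
  have -> : (N * 2).+1 = (N.+1 + N)%N by lia.
  by rewrite qpochD qpochS -!exprM; congr (_ * (1 - _ * _ ^+ _) * qpoch (_ * _ ^+ _) _ _); lia.
by rewrite qpochS [in qpoch x q _]muln2 qpoch_double; ring.
Qed.
End Inversion.

(** * Rearrangement of finite sums *)

Section Sums.
Variable V : nmodType.

Lemma sum_triangle n (f : nat -> nat -> V) :
  \sum_(k < n.+1) \sum_(j < k.+1) f k j
  = \sum_(j < n.+1) \sum_(i < (n - j).+1) f (j + i)%N j.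
Proof.
elim: n => [|n IHn]; first by rewrite !big_ord1 /= ?subnn ?big_ord1.
rewrite big_ord_recr /= IHn [RHS]big_ord_recr /= subnn big_ord1 addn0.
rewrite [\sum_(j < n.+2) f _ _]big_ord_recr /= addrA; congr (_ + _).
rewrite -big_split; apply: eq_bigr => j _ /=.
have jn : (j <= n)%N by rewrite -ltnS.
by rewrite subSn // [RHS]big_ord_recr /= addnS subnKC.
Qed.

(** Puts a sum over r on the even indices s = 2r, so that an expansion in r can enter
    [sum_triangle]. *)
Lemma sum_even n (f : nat -> V) :
  \sum_(r < n./2.+1) f r = \sum_(s < n.+1) if odd s then 0 else f s./2.
Proof.
elim: n => [|n IHn]; first by rewrite !big_ord1.
rewrite [RHS]big_ord_recr -IHn /= uphalf_half; case: (odd n) => /=.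
  by rewrite add1n big_ord_recr.
by rewrite add0n addr0.
Qed.

Lemma sum_ord_trunc m n (f : nat -> V) : (m <= n)%N ->
  (forall i, (m < i <= n)%N -> f i = 0) ->
  \sum_(i < n.+1) f i = \sum_(i < m.+1) f i.
Proof.
move=> mn f0; rewrite [RHS](big_ord_widen n.+1 f) // [RHS]big_mkcond /=.
apply: eq_bigr => i _; case: ltnP => // mi.
by rewrite f0 // mi /= -ltnS.
Qed.
End Sums.

(** * Andrews' terminating q-Watson sum *)

Section Watson.
Variables (F : fieldType) (q a c : F).
Hypotheses (q0 : q != 0) (a0 : a != 0) (c0 : c != 0).
Hypothesis ha : forall k, 1 - a * q ^+ k != 0.
Hypothesis hc : forall k, 1 - c * q ^+ k != 0.

Let pa i k : qpoch (a * q ^+ i) q k != 0.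
Proof. by apply: qpoch_neq0 => s _; rewrite -mulrA -exprD. Qed.
Let pa2 i k : qpoch (a * q ^+ i) (q ^+ 2) k != 0.
Proof. by apply: qpoch_neq0 => s _; rewrite -mulrA -exprM -exprD. Qed.
Let pc2 i k : qpoch (c * q ^+ i) (q ^+ 2) k != 0.
Proof. by apply: qpoch_neq0 => s _; rewrite -mulrA -exprM -exprD. Qed.

(** The very-well-poised factor and the factorials free of k in the base-q^2 6phi5 sum with A = a q
    and b = q^2 a/c. *)
Let G r := (1 - a * q ^+ (4 * r).+1) / (1 - a * q)
  * qpochs [:: a * q ^+ 1; a * q ^+ 2 / c] (q ^+ 2) r
  / qpochs [:: q ^+ 2; c * q ^+ 1] (q ^+ 2) r.

(* The 6phi5 sum in base q^2 with parameters aq, q^2 a/c, q^-k and q^(1-k): of the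
   last two, the one with even exponent terminates the series. *)
Let base2_sum (o : bool) N k : k = (o + N * 2)%N -> qpoch (q ^+ 2) (q ^+ 2) N != 0 ->
  \sum_(r < N.+1) G r * (qpoch (q ^+ k)^-1 q r.*2 / qpoch (a * q ^+ k.+2) q r.*2)
     * (c * q ^+ (k * 2)) ^+ r
  = qpoch (a * q ^+ 2) q k * qpoch c (q ^+ 2) k
    / (qpoch c q k * qpoch (a * q ^+ 2) (q ^+ 2) k).
Proof.
move=> kN hN.
(* Of q^-k and q^(1-k), [c'] is the one with odd exponent; the other is (q^2)^-N. *)
pose c' := if o then (q ^+ k)^-1 else q / q ^+ k.
have c'0 : c' != 0 by rewrite /c'; case: ifP => _; rewrite ?mulf_neq0 ?invr_neq0 ?expf_neq0.
have Ec' : a * q * q ^+ 2 / c' = a * q ^+ (k.+2 + o).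
  rewrite /c'; case: (o); rewrite ?invrK ?addn1 ?addn0 !exprS; first by ring.
  by field; rewrite q0 expf_neq0.
have Eb : a * q * q ^+ 2 / (a * q ^+ 2 / c) = c * q ^+ 1.
  by field; rewrite q0 c0 a0.
have Ebc : a * q * q ^+ 2 / (a * q ^+ 2 / c * c') = c * q ^+ (k + o).
  rewrite /c'; case: (o); rewrite ?invrK ?addn1 ?addn0 ?exprS; field;
  by rewrite ?q0 ?c0 ?a0 ?expf_neq0.
have EN : a * q * (q ^+ 2) ^+ N.+1 = a * q ^+ (k.+2 + ~~ o).
  rewrite -mulrA -exprM -exprS; congr (_ * _ ^+ _); move: kN; case: (o) => /=; lia.
have := @phi65_sum F (q ^+ 2) (a * q) (a * q ^+ 2 / c) c' _ _ _ _ _ _ N hN.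
rewrite Ec' Eb EN Ebc => H.
transitivity (qpochs [:: a * q * q ^+ 2; c * q ^+ (k + o)] (q ^+ 2) N /
    qpochs [:: c * q ^+ 1; a * q ^+ (k.+2 + o)] (q ^+ 2) N).
  rewrite -H.
  - apply: eq_bigr => r _; rewrite /G /qpochs !big_cons !big_nil !mulr1.
    have F1 : qpoch (q ^+ k)^-1 q r.*2
              = qpoch c' (q ^+ 2) r * qpoch ((q ^+ 2) ^+ N)^-1 (q ^+ 2) r.
      rewrite qpoch_double -exprM mulnC /c' kN; case: (o).
        rewrite add1n exprS; congr (_ * qpoch _ _ _).
        by field; rewrite q0 expf_neq0.
      by rewrite add0n mulrC; congr (qpoch _ _ _ * _); rewrite mulrC.
    have F2 : qpoch (a * q ^+ k.+2) q r.*2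
      = qpoch (a * q ^+ (k.+2 + o)) (q ^+ 2) r
        * qpoch (a * q ^+ (k.+2 + ~~ o)) (q ^+ 2) r.
      rewrite qpoch_double -mulrA -exprSr.
      by case: (o); rewrite /= ?addn0 ?addn1 // mulrC.
    have F3 : a * q ^+ (k.+2 + ~~ o) / (a * q ^+ 2 / c * c') = c * q ^+ (k * 2).
      rewrite muln2 -addnn [q ^+ (k + k)]exprD /c'.
      case: (o); rewrite /= ?addn0 ?addn1 !exprS; field; by rewrite ?q0 ?a0 ?c0 ?expf_neq0.
    have F4 : a * q * (q ^+ 2) ^+ r.*2 = a * q ^+ (4 * r).+1.
      by rewrite -mulrA -exprM -exprS; congr (_ * _ ^+ _); lia.
    by rewrite F1 F2 F3 F4 expr1 !invfM; ring.
  - by rewrite expf_neq0.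
  - by rewrite !mulf_neq0 ?invr_neq0 ?expf_neq0.
  - by [].
  - by move=> s; rewrite -mulrA -exprM -exprS.
  - by move=> s; rewrite -mulrA -exprM -exprD.
  - by move=> s; rewrite -mulrA -exprM -exprD.
rewrite /qpochs !big_cons !big_nil !mulr1.
(* The closed form in base q^2 becomes the stated quotient by comparing (x; q)_k with (x; q^2)_k, at
   x = c and at x = a q^2. *)
have := qpoch_sqr_base q c o N; rewrite -kN -{2}(expr1 q) => EC.
have := qpoch_sqr_base q (a * q ^+ 2) o N.
have -> : a * q ^+ 2 * q = a * q ^+ 3 by ring.
rewrite -kN -[a * _ * q ^+ (_ + _)]mulrA -exprD add2n -addSn -addSn => EA.
have pc1 : qpoch c q k != 0 by exact: qpoch_neq0.
have pk : qpoch c q k * qpoch (c * q ^+ 1) (q ^+ 2) N * qpoch (a * q ^+ 2) (q ^+ 2) k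
  * qpoch (a * q ^+ (k.+2 + o)) (q ^+ 2) N != 0 by rewrite !mulf_neq0.
apply/eqP; rewrite eqr_div ?mulf_neq0 //; apply/eqP.
transitivity (qpoch (a * q ^+ 2) (q ^+ 2) k * qpoch (a * q ^+ 3) (q ^+ 2) N
   * (qpoch c q k * qpoch (c * q ^+ (k + o)) (q ^+ 2) N)).
  have -> : a * q * q ^+ 2 = a * q ^+ 3 by ring.
  by ring.
by rewrite EA -EC; ring.
Qed.

(* Half of an inverse pair: [qpoch_partial_sum] with K = n - s inverts it. *)
Lemma watson_coef_expansion k : qpoch q q k != 0 ->
  qpoch c (q ^+ 2) k / (qpoch q q k * qpoch (a * q ^+ 2) (q ^+ 2) k * qpoch c q k)
  = \sum_(r < k./2.+1) G r * c ^+ r * q ^+ 'C(r.*2, 2)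
      / (qpoch q q (k - r.*2) * qpoch (a * q ^+ 2) q (k + r.*2)).
Proof.
move=> hk.
have hk' j : (j <= k)%N -> qpoch q q j != 0 by move=> jk; exact: qpoch_neq0_le hk.
have kN : k = (odd k + k./2 * 2)%N by rewrite muln2 odd_double_half.
have h2 : qpoch (q ^+ 2) (q ^+ 2) k./2 != 0.
  have: qpoch q q (k./2).*2 != 0 by apply: hk'; lia.
  by rewrite qpoch_double -expr2 mulf_eq0 negb_or; case/andP.
have E := base2_sum kN h2.
have pc1 : qpoch c q k != 0 by exact: qpoch_neq0.
(* Dividing the base-q^2 sum by (q; q)_k (a q^2; q)_k turns its k-dependent factorials of length 2r
   into (q; q)_(k-2r) and (a q^2; q)_(k+2r). *)
transitivity ((qpoch (a * q ^+ 2) q k * qpoch c (q ^+ 2) k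
    / (qpoch c q k * qpoch (a * q ^+ 2) (q ^+ 2) k)) / (qpoch q q k * qpoch (a * q ^+ 2) q k)).
  by field; rewrite hk pc1 pa pa2.
rewrite -E mulr_suml; apply: eq_bigr => r _.
have rk : (r.*2 <= k)%N by have := ltn_ord r; lia.
have := qpoch_inv_q q0 rk; rewrite -signr_odd odd_double mul1r => I.
have -> : qpoch (a * q ^+ 2) q (k + r.*2)
    = qpoch (a * q ^+ 2) q k * qpoch (a * q ^+ k.+2) q r.*2.
  by rewrite qpochD -[a * _ * _]mulrA -exprD.
have -> : qpoch (q ^+ k)^-1 q r.*2
    = q ^+ 'C(r.*2, 2) * qpoch q q k / (qpoch q q (k - r.*2) * q ^+ (k * 2) ^+ r).
  rewrite -I -exprM -mulnA mul2n; field; rewrite ?mul1r.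
  by rewrite expf_neq0 // hk' // leq_subr.
rewrite exprMn; field.
by rewrite hk hk' ?leq_subr // !pa !expf_neq0.
Qed.

(** Orthogonality of the inverse pair: once the factors of length s are pulled out,
    [qpoch_partial_sum] applies with y = q^(s-n), x = a q^(2s+1), K = n - s. Its value contains
    (q^(1-K); q)_K, which is 0 for K > 0. *)
Let inner_sum n s : (s <= n)%N -> qpoch q q n != 0 ->
  \sum_(j < (n - s).+1) qpochs [:: (q ^+ n)^-1; a * q ^+ n.+1] q (s + j) * q ^+ (s + j)
    / (qpoch q q j * qpoch (a * q ^+ 2) q (s + j + s))
  = if s == n then qpochs [:: (q ^+ n)^-1; a * q ^+ n.+1] q n * q ^+ n
       / qpoch (a * q ^+ 2) q (n + n) else 0.
Proof.
move=> sn hn.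
have hq : qpoch q q (n - s) != 0.
  exact: qpoch_neq0_le (leq_subr _ _) hn.
pose x := a * q ^+ (s + s).+1; pose y := (q ^+ (n - s))^-1.
have Ex : x * q = a * q ^+ (s + s).+2 by rewrite -mulrA -exprSr.
have y0 : y != 0 by rewrite invr_neq0 ?expf_neq0.
have hx k : 1 - x * q * q ^+ k != 0 by rewrite Ex -mulrA -exprD.
have En : q ^+ n = q ^+ s * q ^+ (n - s) by rewrite -exprD subnKC.
transitivity (qpochs [:: (q ^+ n)^-1; a * q ^+ n.+1] q s * q ^+ s
   / qpoch (a * q ^+ 2) q (s + s) * (qpochs [:: y * q; x * q / y] q (n - s)
       / qpochs [:: q; x * q] q (n - s))).
  rewrite -qpoch_partial_sum // mulr_sumr; apply: eq_bigr => j _.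
  rewrite /qpochs !big_cons !big_nil !mulr1 addnAC !qpochD exprD.
  have -> : (q ^+ n)^-1 * q ^+ s = y by rewrite En /y; field; rewrite !expf_neq0.
  have -> : a * q ^+ n.+1 * q ^+ s = x / y.
    by rewrite /x /y invrK exprS En exprS exprD; ring.
  have -> : a * q ^+ 2 * q ^+ (s + s) = x * q by rewrite Ex -mulrA -exprD.
  by rewrite !invfM; ring.
case: eqP => [e|/eqP ne].
  by rewrite -e subnn /qpochs !big_cons !big_nil !qpoch0 !mulr1 invr1 !mulr1.
rewrite /qpochs !big_cons !big_nil.
rewrite (@qpoch_eq0 _ (y * q) _ _ (n - s).-1) ?mul0r ?mulr0 //; first by lia.
rewrite -mulrA -exprS prednK ?mulVf ?expf_neq0 //; lia.
Qed.

(** Expanding each term by [watson_coef_expansion] and summing over k first leaves only s = n by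
    [inner_sum]. As s = 2r is even, nothing remains for odd n. *)
Lemma q_watson n : qpoch q q n != 0 ->
  \sum_(k < n.+1) qpochs [:: (q ^+ n)^-1; a * q ^+ n.+1] q k * qpoch c (q ^+ 2) k
     / (qpoch q q k * qpoch (a * q ^+ 2) (q ^+ 2) k * qpoch c q k) * q ^+ k
  = if odd n then 0 else c ^+ n./2 * qpochs [:: q; a * q ^+ 2 / c] (q ^+ 2) n./2
       / qpochs [:: a * q ^+ 2; c * q] (q ^+ 2) n./2.
Proof.
move=> hn.
pose h s := G s./2 * c ^+ s./2 * q ^+ 'C(s, 2).
pose f k s := if odd s then 0 else h s * (qpochs [:: (q ^+ n)^-1; a * q ^+ n.+1] q k
   * q ^+ k / (qpoch q q (k - s) * qpoch (a * q ^+ 2) q (k + s))).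
transitivity (\sum_(k < n.+1) \sum_(s < k.+1) f k s).
  apply: eq_bigr => k _; have -> (p u v w : F) : p * u / v * w = p * w * (u / v) by ring.
  rewrite watson_coef_expansion; last first.
    by apply: qpoch_neq0_le hn; rewrite -ltnS.
  rewrite (sum_even k (fun r => G r * c ^+ r * q ^+ 'C(r.*2, 2)
      / (qpoch q q (k - r.*2) * qpoch (a * q ^+ 2) q (k + r.*2)))) mulr_sumr.
  apply: eq_bigr => s _; rewrite /f; case: ifP => os; first by rewrite mulr0.
  by rewrite /h even_halfK ?os //; ring.
rewrite sum_triangle.
transitivity (\sum_(s < n.+1) if s == n :> nat then f n s else 0).
  apply: eq_bigr => s _; rewrite /f; case os: (odd s); first by rewrite big1 ?if_same.
  have sn : (s <= n)%N by rewrite -ltnS.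
  rewrite -mulr_sumr.
  under eq_bigr => j _ do rewrite addKn.
  rewrite inner_sum //; case: eqP => [->|]; last by rewrite mulr0.
  by rewrite subnn qpoch0 mul1r.
rewrite big_ord_recr /= eqxx big1 ?add0r; last first.
  by move=> s _; rewrite ltn_eqF.
rewrite /f; case: ifP => // on.
have := @qpoch_inv_q _ q n n q0 (leqnn n).
rewrite -signr_odd on subnn qpoch0 !mul1r mulr1 => I.
have nn : q ^+ (n * n) = q ^+ 'C(n, 2) * q ^+ 'C(n, 2) * q ^+ n.
  rewrite -!exprD; congr (_ ^+ _); elim: {+}n => [|m IHm] //.
  by rewrite binS bin1; move: IHm; nia.
(* The square n^2 = 2 binom(n, 2) + n makes the power of q carried by the surviving term exactly the
   one that turns (q^-n; q)_n into (q; q)_n; the sign is 1 since n is even. *)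
have {I} : qpoch (q ^+ n)^-1 q n * q ^+ n * q ^+ 'C(n, 2) = qpoch q q n.
  have b0 : q ^+ 'C(n, 2) != 0 by rewrite expf_neq0.
  by apply: (mulfI b0); rewrite -I nn; ring.
have nr : n = n./2.*2 by rewrite even_halfK ?on.
(* Both sides are (a q; q)_(2n+1), with either its first factor or its last one split off; the last
   one is the numerator of the very-well-poised factor in [G]. *)
have Ea : qpoch (a * q ^+ 2) q (n + n) * (1 - a * q)
    = qpoch (a * q) (q ^+ 2) n./2 * qpoch (a * q ^+ 2) (q ^+ 2) n./2
      * qpoch (a * q ^+ n.+1) q n * (1 - a * q ^+ (4 * n./2).+1).
  have -> : a * q ^+ 2 = a * q * q by ring.
  rewrite mulrC -qpochSl qpochS qpochD -qpoch_double -nr.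
  have -> : (4 * n./2).+1 = (n + n).+1 by lia.
  by rewrite !exprS !mulrA.
have Eq : qpoch q q n = qpoch q (q ^+ 2) n./2 * qpoch (q * q) (q ^+ 2) n./2.
  by rewrite {1}nr qpoch_double.
have h2 : qpoch (q ^+ 2) (q ^+ 2) n./2 != 0.
  by move: hn; rewrite Eq -expr2 mulf_eq0 negb_or => /andP[].
rewrite Eq -expr2 /h /G /qpochs !big_cons !big_nil !mulr1 expr1 => I.
have h1 : 1 - a * q != 0 by have := ha 1.
have h3 := pa 2 (n + n); have h4 := pa2 2 n./2; have := pc2 1 n./2; rewrite expr1 => h5.
have [h6 h7] : qpoch (a * q) (q ^+ 2) n./2 != 0 /\ qpoch (a * q ^+ n.+1) q n != 0.
  by split; [have := pa2 1 n./2; rewrite expr1 | exact: pa].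
transitivity (c ^+ n./2 * qpoch (a * q ^+ 2 / c) (q ^+ 2) n./2
  / qpoch (c * q) (q ^+ 2) n./2 / qpoch (q ^+ 2) (q ^+ 2) n./2
  * (qpoch (q ^+ n)^-1 q n * q ^+ n * q ^+ 'C(n, 2))
  * (qpoch (a * q) (q ^+ 2) n./2 * qpoch (a * q ^+ n.+1) q n * (1 - a * q ^+ (4 * n./2).+1))
  / (qpoch (a * q ^+ 2) q (n + n) * (1 - a * q))).
  by rewrite !invfM ?mul1r; ring.
by rewrite I Ea; field; rewrite h5 h4 ha h7 h6 h2.
Qed.
End Watson.

(** * The expansion in j, reducing m to 0 *)

Section ShiftM.
Variables (F : fieldType) (q a c sc : F).
Hypotheses (q0 : q != 0) (a0 : a != 0) (c0 : c != 0) (scE : sc ^+ 2 = c).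
Hypothesis ha : forall k, 1 - a * q ^+ k != 0.
Hypothesis hc : forall k, 1 - c / q * q ^+ k != 0.

Let hc0 k : 1 - c * q ^+ k != 0.
Proof. by have := hc k.+1; rewrite exprS mulrA divfK. Qed.

Let hsc k : 1 - - sc * q ^+ k != 0.
Proof.
have := hc0 (k * 2); apply: contraNneq => h.
have -> : 1 - c * q ^+ (k * 2) = (1 - - sc * q ^+ k) * (1 - sc * q ^+ k).
  by rewrite -scE exprM; ring.
by rewrite h mul0r.
Qed.

(** This is the 6phi5 sum with A = c/q, b = -sqrt c, third parameter q^-m and terminator q^-k. Since
    b^2 = A q, the factorials of b and A q/b cancel in the summand. *)
Let shift_coef m k : qpoch q q k != 0 ->
  qpoch (- (q ^+ m * sc)) q k / (qpoch q q k * qpoch (q ^+ m * c) q k)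
  = qpoch (- sc) q k / qpoch c q k *
   \sum_(j < k.+1) (1 - c / q * q ^+ (j + j)) / (1 - c / q) * qpoch (c / q) q j
     * qpoch (q ^+ m)^-1 q j / (qpoch q q j * qpoch (q ^+ m * c) q j)
     * sc ^+ j * q ^+ (m * j + 'C(j, 2)) / (qpoch q q (k - j) * qpoch (c * q ^+ k) q j).
Proof.
move=> hk.
have sc0 : sc != 0 by apply: contraNneq c0 => h; rewrite -scE h expr0n.
have Eb : c / q * q / - sc = - sc by rewrite -scE; field; rewrite ?oppr_eq0 ?sc0 q0.
have Ec : c / q * q / (q ^+ m)^-1 = q ^+ m * c by rewrite invrK divfK // mulrC.
have Ebc : c / q * q / (- sc * (q ^+ m)^-1) = - (q ^+ m * sc).
  by rewrite -scE; field; rewrite ?oppr_eq0 ?sc0 q0 expf_neq0.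
have Ek : c / q * q ^+ k.+1 = c * q ^+ k by rewrite exprS mulrA divfK.
have hb s : 1 - c / q * q / - sc * q ^+ s != 0 by rewrite Eb.
have hm s : 1 - c / q * q / (q ^+ m)^-1 * q ^+ s != 0.
  by rewrite Ec mulrAC [_ * c]mulrC -exprD.
have b0 : - sc != 0 by rewrite oppr_eq0.
have m0 : (q ^+ m)^-1 != 0 by rewrite invr_neq0 ?expf_neq0.
have := phi65_sum q0 b0 m0 hc hb hm hk.
rewrite Eb Ec Ebc Ek divfK // => H.
have p1 j : qpoch (- sc) q j != 0 by apply: qpoch_neq0.
have p2 i j : qpoch (c * q ^+ i) q j != 0.
  by apply: qpoch_neq0 => s _; rewrite -mulrA -exprD.
have p3 j : qpoch (q ^+ m * c) q j != 0 by rewrite mulrC.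
have p4 j : qpoch c q j != 0 by apply: qpoch_neq0.
transitivity (qpoch (- sc) q k / (qpoch c q k * qpoch q q k)
   * (qpochs [:: c; - (q ^+ m * sc)] q k / qpochs [:: - sc; q ^+ m * c] q k)).
  by rewrite /qpochs !big_cons !big_nil !mulr1; field; rewrite p3 hk p1 p4.
rewrite -H.
rewrite invfM -!mulrA; congr (_ * (_ * _)); rewrite mulr_sumr; apply: eq_bigr => j _.
have jk : (j <= k)%N by rewrite -ltnS.
rewrite /qpochs !big_cons !big_nil !mulr1.
have I := qpoch_inv_q q0 jk.
have pj := qpoch_neq0_le jk hk.
have pkj := qpoch_neq0_le (leq_subr j k) hk.
have -> : qpoch (q ^+ k)^-1 q j
    = (- 1) ^+ j * q ^+ 'C(j, 2) * qpoch q q k / (qpoch q q (k - j) * q ^+ (k * j)).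
  by rewrite -I; field; rewrite pkj expf_neq0.
have -> : (c * (q ^+ k / (- sc / q ^+ m))) ^+ j
    = (-1) ^+ j * sc ^+ j * q ^+ (k * j) * q ^+ (m * j).
  rewrite !exprM -!exprMn; congr (_ ^+ _); rewrite -scE; field.
  by rewrite ?oppr_eq0 sc0 ?expf_neq0.
have s1 : (-1) ^+ j * (-1) ^+ j = 1 :> F by rewrite -exprD addnn -signr_odd odd_double.
have h1 : 1 - c / q != 0 by have := hc 0; rewrite mulr1.
have h2 : q ^+ (k * j) != 0 by rewrite expf_neq0.
rewrite -addnn [q ^+ (m * j + _)]exprD !invfM; move: ((-1) ^+ j) s1 => e s1.
(* The sign (-1)^j arises twice, from (q^-k; q)_j and from the argument of the series. Inserting it
   and the cancelling factors on the right lets [ring] conclude with inverses as atoms. *)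
set rhs := (X in _ = X); transitivity (e * e * rhs); last by rewrite s1 mul1r.
by rewrite -[_ * rhs](mulfK h2) -[_ * rhs](mulfK (p1 j)) -[_ * rhs](mulfK hk) /rhs; ring.
Qed.

(** The factor (-sqrt c; q)_k released by [shift_coef] joins (sqrt c; q)_k to form (c; q^2)_k. After
    exchanging sums, the sum over k = j + i is therefore [q_watson] at a q^(2j), c q^(2j) and N -
    j. *)
Lemma watson_shift_m N m : qpoch q q N != 0 ->
  \sum_(k < N.+1) qpochs [:: (q ^+ N)^-1; a * q ^+ N.+1; sc; - (q ^+ m * sc)] q k
     / (qpoch q q k * qpoch (a * q ^+ 2) (q ^+ 2) k * qpoch (q ^+ m * c) q k) * q ^+ k
  = \sum_(j < N.+1) if odd (N - j) then 0 else
     qpochs [:: (q ^+ m)^-1; (q ^+ N)^-1; a * q ^+ N.+1; sc; - sc] q j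
     / (qpoch q q j * qpoch (a * q ^+ 2) (q ^+ 2) j * qpoch (q ^+ m * c) q j
        * qpoch (c * q ^+ j / q) q j)
     * sc ^+ j * q ^+ (m * j + 'C(j, 2) + j)
     * ((c * q ^+ (j + j)) ^+ (N - j)./2
        * qpochs [:: q; a * q ^+ 2 / c] (q ^+ 2) (N - j)./2
        / qpochs [:: a * q ^+ (j + j).+2; c * q ^+ (j + j).+1] (q ^+ 2) (N - j)./2).
Proof.
move=> hN.
pose u j := (1 - c / q * q ^+ (j + j)) / (1 - c / q) * qpoch (c / q) q j
     * qpoch (q ^+ m)^-1 q j / (qpoch q q j * qpoch (q ^+ m * c) q j)
     * sc ^+ j * q ^+ (m * j + 'C(j, 2)).
pose f k j := qpochs [:: (q ^+ N)^-1; a * q ^+ N.+1] q k * qpoch c (q ^+ 2) k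
  / (qpoch (a * q ^+ 2) (q ^+ 2) k * qpoch c q k) * q ^+ k
  * (u j / (qpoch q q (k - j) * qpoch (c * q ^+ k) q j)).
transitivity (\sum_(k < N.+1) \sum_(j < k.+1) f k j).
  apply: eq_bigr => k _.
  have hk : qpoch q q k != 0 by apply: qpoch_neq0_le hN; rewrite -ltnS.
  rewrite -mulr_sumr /qpochs !big_cons !big_nil !mulr1.
  have := shift_coef m hk; rewrite /u.
  set S := \sum_(j < k.+1) _ => E.
  have -> (p1 p2 p3 p4 d1 d2 d3 z : F) : p1 * (p2 * (p3 * p4)) / (d1 * d2 * d3) * z
    = p1 * p2 * p3 / d2 * z * (p4 / (d1 * d3)) by rewrite !invfM; ring.
  by rewrite E -scE -qpochN !invfM; ring.
rewrite sum_triangle; apply: eq_bigr => j _.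
have jN : (j <= N)%N by rewrite -ltnS.
have aj0 : a * q ^+ (j + j) != 0 by rewrite mulf_neq0 ?expf_neq0.
have cj0 : c * q ^+ (j + j) != 0 by rewrite mulf_neq0 ?expf_neq0.
have haj k : 1 - a * q ^+ (j + j) * q ^+ k != 0 by rewrite -mulrA -exprD.
have hcj k : 1 - c * q ^+ (j + j) * q ^+ k != 0 by rewrite -mulrA -exprD.
have W := q_watson q0 aj0 cj0 haj hcj (qpoch_neq0_le (leq_subr j N) hN).
have Er : a * q ^+ (j + j) * q ^+ 2 / (c * q ^+ (j + j)) = a * q ^+ 2 / c.
  by field; rewrite c0 expf_neq0.
have Ea : a * q ^+ (j + j) * q ^+ 2 = a * q ^+ (j + j).+2 by rewrite -mulrA -exprD addn2.
have Ec : c * q ^+ (j + j) * q = c * q ^+ (j + j).+1 by rewrite -mulrA -exprSr.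
rewrite Er Ea Ec in W.
pose v := qpochs [:: (q ^+ m)^-1; (q ^+ N)^-1; a * q ^+ N.+1; sc; - sc] q j
     / (qpoch q q j * qpoch (a * q ^+ 2) (q ^+ 2) j * qpoch (q ^+ m * c) q j
        * qpoch (c * q ^+ j / q) q j)
     * sc ^+ j * q ^+ (m * j + 'C(j, 2) + j).
set rhs := (X in _ = X).
have -> : rhs = v * (if odd (N - j) then 0 else (c * q ^+ (j + j)) ^+ (N - j)./2
        * qpochs [:: q; a * q ^+ 2 / c] (q ^+ 2) (N - j)./2
        / qpochs [:: a * q ^+ (j + j).+2; c * q ^+ (j + j).+1] (q ^+ 2) (N - j)./2).
  by rewrite /rhs; case: ifP; rewrite ?mulr0 // /v !mulrA.
rewrite -W mulr_sumr; apply: eq_bigr => i _; rewrite /f /u /v addKn.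
have E1 : (q ^+ N)^-1 * q ^+ j = (q ^+ (N - j))^-1.
  have -> : q ^+ N = q ^+ j * q ^+ (N - j) by rewrite -exprD subnKC.
  by field; rewrite !expf_neq0.
have E2 : a * q ^+ N.+1 * q ^+ j = a * q ^+ (j + j) * q ^+ (N - j).+1.
  by rewrite -!mulrA -!exprD; congr (_ * _ ^+ _); lia.
have E3 : c * (q ^+ 2) ^+ j = c * q ^+ (j + j) by rewrite -exprM mul2n addnn.
have E4 : a * q ^+ 2 * (q ^+ 2) ^+ j = a * q ^+ (j + j).+2.
  by rewrite -exprM -mulrA -exprD add2n mul2n addnn.
have h1 : 1 - c / q != 0 by have := hc 0; rewrite mulr1.
have p1 x k : qpoch (c * q ^+ x) q k != 0.
  by apply: qpoch_neq0 => s _; rewrite -mulrA -exprD.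
have p2 k : qpoch c q k != 0 by apply: qpoch_neq0.
(* Splitting (c; q)_(2j+i) in two ways and using (c/q; q)_(2j+1) = (1 - c/q) (c; q)_(2j) cancels the
   very-well-poised factor; this is the origin of (q^(j-1) c; q)_j. *)
have X : (qpoch c q (j + i))^-1 / qpoch (c * q ^+ (j + i)) q j
   = (1 - c / q) / ((1 - c / q * q ^+ (j + j)) * qpoch (c / q) q j * qpoch (c * q ^+ j / q) q j
       * qpoch (c * q ^+ (j + j)) q i).
  have -> : (1 - c / q * q ^+ (j + j)) * qpoch (c / q) q j * qpoch (c * q ^+ j / q) q j
      = (1 - c / q) * qpoch c q (j + j).
    rewrite [c * q ^+ j / q]mulrAC -mulrA -qpochD mulrC -qpochS qpochSl.
    by rewrite divfK.
  have Z : qpoch c q (j + i) * qpoch (c * q ^+ (j + i)) q j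
      = qpoch c q (j + j) * qpoch (c * q ^+ (j + j)) q i.
    by rewrite -!qpochD addnAC.
  by rewrite -invfM Z; move: (1 - c / q) h1 => z z0; field; rewrite z0 !p1 p2.
have -> (x1 x2 A B d1 d2 z u' : F) : x1 * x2 / (d1 * A) * z * (u' / (d2 * B))
    = x1 * x2 / d1 * z * u' / d2 * (A^-1 / B) by rewrite !invfM; ring.
rewrite X /qpochs !big_cons !big_nil !mulr1 !qpochD E1 E2 E3 E4.
rewrite [q ^+ (j + i)]exprD [q ^+ (m * j + _ + j)]exprD.
have -> : qpoch c (q ^+ 2) j = qpoch sc q j * qpoch (- sc) q j by rewrite qpochN scE.
have h3 : qpoch (c / q) q j != 0 by apply: qpoch_neq0.
have h2 := hc (j + j); rewrite !invfM.
set rh := (X in _ = X).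
transitivity (rh * (1 - c / q) / (1 - c / q) * (1 - c / q * q ^+ (j + j))
   / (1 - c / q * q ^+ (j + j)) * qpoch (c / q) q j / qpoch (c / q) q j).
  by rewrite /rh; ring.
by rewrite !mulfK.
Qed.
End ShiftM.

(** * The expansion in i, reducing l to 0 *)

Section ShiftL.
Variables (F : fieldType) (q a sa : F).
Hypotheses (q0 : q != 0) (a0 : a != 0) (saE : sa ^+ 2 = a).
Hypothesis ha : forall k, 1 - a * q ^+ k != 0.
Hypothesis hai : forall m k, 1 - (a * q ^+ m)^-1 * q ^+ k != 0.

Let sa0 : sa != 0.
Proof. by apply: contraNneq a0 => h; rewrite -saE h expr0n. Qed.

Let hs k : 1 - sa * q ^+ k != 0.
Proof.
have := ha (k * 2); apply: contraNneq => h.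
have -> : 1 - a * q ^+ (k * 2) = (1 - sa * q ^+ k) * (1 + sa * q ^+ k).
  by rewrite -saE exprM; ring.
by rewrite h mul0r.
Qed.

Let hsi m k : 1 - (sa * q ^+ m)^-1 * q ^+ k != 0.
Proof.
have := hai (m * 2) (k * 2); apply: contraNneq => h.
have -> : 1 - (a * q ^+ (m * 2))^-1 * q ^+ (k * 2)
    = (1 - (sa * q ^+ m)^-1 * q ^+ k) * (1 + (sa * q ^+ m)^-1 * q ^+ k).
  by rewrite -saE !exprM -exprMn -exprVn; ring.
by rewrite h mul0r.
Qed.

(** A form of [qpoch_inv] whose side condition has no predecessor, so that matching exponents is
    left to [lia]. *)
Let qpoch_inv_shift x y s : x != 0 -> y * q = x * q ^+ s ->
  qpoch y^-1 q s = (- x^-1) ^+ s * (q ^+ 'C(s, 2))^-1 * qpoch x q s.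
Proof.
case: s => [|s] x0 E; first by rewrite !qpoch0 bin0n expr0 invr1 !mulr1.
rewrite -qpoch_inv //=; congr (qpoch _^-1 _ _).
by apply: (mulIf q0); rewrite E exprSr mulrA.
Qed.

(** The part free of k of the i-th term of the 6phi5 sum with A = q^(-2l-2n-1)/a and parameters q^-l
    and d = q^(-l-n)/sqrt a. The factorials of d cancel because d^2 = A q; those of q^-n and
    q^(-2l-n)/a are what the terminator leaves once its dependence on k is removed. *)
Definition l_coef l n i :=
  (1 - (a * q ^+ (l.*2 + n.*2).+1)^-1 * q ^+ (i + i)) / (1 - (a * q ^+ (l.*2 + n.*2).+1)^-1)
  * qpochs [:: (q ^+ l)^-1; (q ^+ n)^-1; (a * q ^+ (l.*2 + n.*2).+1)^-1] q i
  / qpochs [:: q; (a * q ^+ (l + n.*2))^-1; (a * q ^+ (l.*2 + n))^-1] q i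
  / sa ^+ i.

(** Once the factors depending on k alone are pulled out, the sum over i is a 6phi5 sum with
    terminator q^-(n-k). Its value has factorials of length n - k; splitting them at k separates the
    prefactor free of k. *)
Lemma term_shift_l l n k : qpoch q q n != 0 -> (k <= n)%N ->
  qpochs [:: (q ^+ n)^-1; a * q ^+ (l + n).+1] q k / qpoch (sa * q) q k
  = qpochs [:: a * q ^+ (l + n).+1; sa * q ^+ n.+1] q l
    / qpochs [:: a * q ^+ (l + n.*2).+1; sa * q] q l
    * \sum_(i < n.+1) l_coef l n i * qpochs [:: (q ^+ (n - i))^-1; a * q ^+ (l.*2 + (n - i)).+1] q k
      / qpoch (sa * q ^+ l.+1) q k.
Proof.
move=> hn kn.
pose A := (a * q ^+ (l.*2 + n.*2).+1)^-1.
pose d := (sa * q ^+ (l + n))^-1.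
have hA j : 1 - A * q ^+ j != 0 by exact: hai.
have l0 : (q ^+ l)^-1 != 0 by rewrite invr_neq0 ?expf_neq0.
have d0 : d != 0 by rewrite invr_neq0 ?mulf_neq0 ?expf_neq0.
have qinv x i j : x != 0 -> (x * q ^+ (i + j))^-1 * q ^+ i = (x * q ^+ j)^-1.
  by move=> x0; rewrite exprD; field; rewrite x0 !expf_neq0.
have EA : A * q = (a * q ^+ (l.*2 + n.*2))^-1.
  by rewrite -[q in LHS]expr1 /A -add1n qinv.
have El : A * q / (q ^+ l)^-1 = (a * q ^+ (l + n.*2))^-1.
  by rewrite invrK EA -addnn -addnA qinv.
have Ed : A * q / d = d.
  rewrite EA /d invrK -saE -addnn -addnn addnACA exprD; field.
  by rewrite sa0 expf_neq0.
have Eld : A * q / ((q ^+ l)^-1 * d) = (sa * q ^+ n)^-1.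
  by rewrite [_ * d]mulrC invfM mulrA Ed invrK qinv.
have En : A * q ^+ (n - k).+1 = (a * q ^+ (l.*2 + n + k))^-1.
  rewrite exprS mulrA EA.
  have -> : (l.*2 + n.*2 = n - k + (l.*2 + n + k))%N by lia.
  by rewrite qinv.
have := @phi65_sum F q A (q ^+ l)^-1 d q0 l0 d0 hA _ _ (n - k)
          (qpoch_neq0_le (leq_subr k n) hn).
rewrite El Ed Eld En EA => /(_ (hai _) (hsi _)) H.
have pa e j : qpoch (a * q ^+ e) q j != 0.
  by apply: qpoch_neq0 => s _; rewrite -mulrA -exprD.
have ps e j : qpoch (sa * q ^+ e) q j != 0.
  by apply: qpoch_neq0 => s _; rewrite -mulrA -exprD.
have pai e j : qpoch (a * q ^+ e)^-1 q j != 0 by apply: qpoch_neq0 => s _; exact: hai.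
have pd j : qpoch d q j != 0 by apply: qpoch_neq0 => s _; exact: hsi.
pose K := qpochs [:: (q ^+ n)^-1; a * q ^+ (l.*2 + n).+1] q k / qpoch (sa * q ^+ l.+1) q k.
have -> : \sum_(i < n.+1) l_coef l n i * qpochs [:: (q ^+ (n - i))^-1; a * q ^+ (l.*2 + (n - i)).+1] q k
      / qpoch (sa * q ^+ l.+1) q k
  = K * (qpochs [:: (a * q ^+ (l.*2 + n.*2))^-1; (sa * q ^+ n)^-1] q (n - k)
         / qpochs [:: (a * q ^+ (l + n.*2))^-1; d] q (n - k)).
  pose f i := l_coef l n i * qpochs [:: (q ^+ (n - i))^-1; a * q ^+ (l.*2 + (n - i)).+1] q k
      / qpoch (sa * q ^+ l.+1) q k.
  (* For i > n - k the factor (q^-(n-i); q)_k is 0. *)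
  rewrite (@sum_ord_trunc _ (n - k) n f) ?leq_subr //; last first.
    move=> i /andP[ki ni]; rewrite /f /qpochs !big_cons.
    rewrite (@qpoch_eq0 _ _ _ k (n - i)) ?mul0r ?mulr0 ?mul0r //; first by lia.
    by rewrite mulVf ?expf_neq0.
  rewrite -H mulr_sumr; apply: eq_bigr => i _; rewrite /f.
  have ik : (i <= n - k)%N by rewrite -ltnS.
  have ni : (i <= n)%N by lia.
  (* Both sides are (q^-n; q)_(k+i). *)
  have T1 : qpoch (q ^+ n)^-1 q k * qpoch (q ^+ (n - k))^-1 q i
      = qpoch (q ^+ n)^-1 q i * qpoch (q ^+ (n - i))^-1 q k.
    have e j : (j <= n)%N -> (q ^+ (n - j))^-1 = (q ^+ n)^-1 * q ^+ j.
      move=> jn; have -> : q ^+ n = q ^+ j * q ^+ (n - j) by rewrite -exprD subnKC.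
      by field; rewrite !expf_neq0.
    by rewrite !e // -!qpochD addnC.
  pose x := a * q ^+ (l.*2 + (n - i)).+1.
  have x0 : x != 0 by rewrite mulf_neq0 ?expf_neq0.
  have xk0 : x * q ^+ k != 0 by rewrite mulf_neq0 ?expf_neq0.
  (* Reversing the factorials with inverse argument turns both sides into the same multiple of (x;
     q)_(i+k). *)
  have T2 : qpoch (a * q ^+ (l.*2 + n).+1) q k * qpoch (a * q ^+ (l.*2 + n))^-1 q i
      = qpoch x q k * qpoch (a * q ^+ (l.*2 + n + k))^-1 q i * (q ^+ k) ^+ i.
    rewrite (@qpoch_inv_shift x); first last.
    - by rewrite /x -!mulrA -!exprD -exprSr; congr (_ * _ ^+ _); lia.
    - by [].
    rewrite (@qpoch_inv_shift (x * q ^+ k)); first last.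
    - by rewrite /x -!mulrA -!exprD -exprSr; congr (_ * _ ^+ _); lia.
    - by [].
    have -> : (- (x * q ^+ k)^-1) ^+ i = (- x^-1) ^+ i / (q ^+ k) ^+ i.
      by rewrite -exprVn -exprMn; congr (_ ^+ _); rewrite invfM; ring.
    have -> : a * q ^+ (l.*2 + n).+1 = x * q ^+ i.
      by rewrite /x -!mulrA -!exprD; congr (_ * _ ^+ _); lia.
    transitivity ((- x^-1) ^+ i * (q ^+ 'C(i, 2))^-1 * qpoch x q (i + k)).
      by rewrite qpochD; ring.
    by rewrite addnC qpochD; field; rewrite !expf_neq0.
  have Ez : (a * q ^+ (l.*2 + n + k))^-1 / ((q ^+ l)^-1 * d) = (sa * q ^+ k)^-1.
    rewrite /d !invfM !invrK -saE -addnn !exprD; field.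
    by rewrite sa0 !expf_neq0.
  rewrite /l_coef /K Ez /qpochs !big_cons !big_nil !mulr1 -/x -/A -addnn.
  have h1 := pai (l.*2 + n)%N i; have h2 := pai (l.*2 + n + k)%N i.
  have h4 : (q ^+ k) ^+ i != 0 by rewrite !expf_neq0.
  have h5 := pa (l.*2 + n).+1 k.
  have {}T2 : qpoch x q k = qpoch (a * q ^+ (l.*2 + n).+1) q k
      * qpoch (a * q ^+ (l.*2 + n))^-1 q i / (qpoch (a * q ^+ (l.*2 + n + k))^-1 q i * (q ^+ k) ^+ i).
    by rewrite T2; field; rewrite h2 h4.
  rewrite T2 exprVn -[i.*2]addnn.
  move: (qpoch (a * _)^-1 q i) (qpoch (a * _)^-1 q i) (qpoch (a * _)^-1 q i) h1 h2 => g1 g2 g3 h1 h2.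
  pose U := (1 - A * q ^+ (i + i)) / (1 - A) * qpoch (q ^+ l)^-1 q i * qpoch A q i
    / qpoch q q i / g1 / sa ^+ i * qpoch (a * q ^+ (l.*2 + n).+1) q k / g2 / (q ^+ k) ^+ i
    / qpoch (sa * q ^+ l.+1) q k.
  transitivity (U * (qpoch (q ^+ n)^-1 q i * qpoch (q ^+ (n - i))^-1 q k) * (g3 / g3)).
    by rewrite /U !invfM; ring.
  by rewrite -T1 divff // mulr1 -[U * _](mulfK (pd i)) /U exprMn !invfM; ring.
rewrite mulrA /K /qpochs !big_cons !big_nil !mulr1.
pose s := (n - k)%N.
have nks : n = (k + s)%N by rewrite subnKC.
(* All four inverse-argument factorials are reversed; the resulting powers agree because the two
   products of arguments are equal. *)
have Cst : qpoch (a * q ^+ (l.*2 + n.*2))^-1 q s * qpoch (sa * q ^+ n)^-1 q s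
   * (qpoch (a * q ^+ (l + n + k).+1) q s * qpoch (sa * q ^+ (l + k).+1) q s)
  = qpoch (a * q ^+ (l + n.*2))^-1 q s * qpoch d q s
   * (qpoch (a * q ^+ (l.*2 + n + k).+1) q s * qpoch (sa * q ^+ k.+1) q s).
  have nz x e : x != 0 -> x * q ^+ e != 0 by move=> x0; rewrite mulf_neq0 ?expf_neq0.
  have Y x e e' : x != 0 -> e.+1 = (e' + s)%N -> qpoch (x * q ^+ e)^-1 q s
     = (- (x * q ^+ e')^-1) ^+ s / (q ^+ 'C(s, 2)) * qpoch (x * q ^+ e') q s.
    by move=> x0 ee; apply: qpoch_inv_shift; rewrite ?nz // -!mulrA -exprSr ee exprD.
  rewrite (Y _ _ (l.*2 + n + k).+1) //; last by lia.
  rewrite (Y _ _ k.+1) //; last by lia.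
  rewrite (Y _ _ (l + n + k).+1) //; last by lia.
  rewrite /d (Y _ _ (l + k).+1) //; last by lia.
  have -> (u1 u2 v w1 w2 w : F) : u1 ^+ s / v * w1 * (u2 ^+ s / v * w2) * w
    = (u1 * u2) ^+ s / v / v * (w1 * w2 * w) by rewrite exprMn; ring.
  have -> (u1 u2 v w1 w2 w : F) : u1 ^+ s / v * w1 * (u2 ^+ s / v * w2) * w
    = (u1 * u2) ^+ s / v / v * (w * (w1 * w2)) by rewrite exprMn; ring.
  congr (_ ^+ s / _ / _ * _); rewrite !mulrNN -!invfM; congr _^-1.
  by rewrite mulrACA [RHS]mulrACA -!exprD; congr (_ * _ ^+ _); lia.
(* [R] replaces length s = n - k by lengths n and k, and [PC] replaces a shift by l of length n by a
   shift by n of length l, which produces the prefactor. *)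
have PD x e i j : qpoch (x * q ^+ e) q (i + j) = qpoch (x * q ^+ e) q i * qpoch (x * q ^+ (e + i)) q j.
  by rewrite qpochD -mulrA -exprD.
have R x e : qpoch (x * q ^+ e) q k != 0 ->
    qpoch (x * q ^+ (e + k)) q s = qpoch (x * q ^+ e) q n / qpoch (x * q ^+ e) q k.
  by move=> x0; rewrite {1}nks PD [RHS]mulrAC divff // mul1r.
have PC x e : qpoch (x * q ^+ e) q l != 0 ->
    qpoch (x * q ^+ (e + l)) q n
    = qpoch (x * q ^+ e) q n * qpoch (x * q ^+ (e + n)) q l / qpoch (x * q ^+ e) q l.
  by move=> x0; rewrite -PD [(n + l)%N]addnC PD [RHS]mulrAC divff // mul1r.
have Cst2 : qpoch (a * q ^+ (l.*2 + n.*2))^-1 q s * qpoch (sa * q ^+ n)^-1 q s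
   / (qpoch (a * q ^+ (l + n.*2))^-1 q s * qpoch d q s)
  = qpoch (a * q ^+ (l.*2 + n + k).+1) q s * qpoch (sa * q ^+ k.+1) q s
    / (qpoch (a * q ^+ (l + n + k).+1) q s * qpoch (sa * q ^+ (l + k).+1) q s).
  by apply/eqP; rewrite eqr_div ?mulf_neq0 //; apply/eqP; rewrite Cst mulrC.
rewrite -/s Cst2 -!addSn -[k.+1]add1n -[n.+1]add1n !R //.
have -> : ((l.*2).+1 + n = (l.+1 + n) + l)%N by lia.
have -> : (l.+1 + n.*2 = l.+1 + n + n)%N by lia.
have -> : l.+1 = (1 + l)%N by [].
rewrite !PC // -[sa * q]/(sa * q ^+ 1).
by field; rewrite !pa !ps.
Qed.
End ShiftL.

(** * The identity for generic parameters *)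

Section Generic.
Variables (F : fieldType) (q a c sa sc : F) (l m n : nat).
Hypotheses (two0 : (2 : F) != 0) (q0 : q != 0) (a0 : a != 0) (c0 : c != 0).
Hypotheses (saE : sa ^+ 2 = a) (scE : sc ^+ 2 = c) (hn : qpoch q q n != 0).
Hypothesis ha : forall k, 1 - a * q ^+ k != 0.
Hypothesis hai : forall m k, 1 - (a * q ^+ m)^-1 * q ^+ k != 0.
Hypothesis hc : forall k, 1 - c / q * q ^+ k != 0.

(** The summand of [watson_shift_m], with [a] and [N] as arguments because it is taken at a q^(2l)
    and n - i. *)
Definition m_coef a N j :=
  if odd (N - j) then 0 else
     qpochs [:: (q ^+ m)^-1; (q ^+ N)^-1; a * q ^+ N.+1; sc; - sc] q j
     / (qpoch q q j * qpoch (a * q ^+ 2) (q ^+ 2) j * qpoch (q ^+ m * c) q j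
        * qpoch (c * q ^+ j / q) q j)
     * sc ^+ j * q ^+ (m * j + 'C(j, 2) + j)
     * ((c * q ^+ (j + j)) ^+ (N - j)./2
        * qpochs [:: q; a * q ^+ 2 / c] (q ^+ 2) (N - j)./2
        / qpochs [:: a * q ^+ (j + j).+2; c * q ^+ (j + j).+1] (q ^+ 2) (N - j)./2).

Lemma l_coef0 i : (l < i)%N -> l_coef q a sa l n i = 0.
Proof.
move=> li; rewrite /l_coef /qpochs !big_cons (@qpoch_eq0 _ _ _ i l) ?mul0r ?mulr0 ?mul0r //.
by rewrite mulVf ?expf_neq0.
Qed.

Lemma m_coef0 b N j : (m < j)%N -> m_coef b N j = 0.
Proof.
move=> mj; rewrite /m_coef /qpochs !big_cons (@qpoch_eq0 _ _ _ j m) ?mul0r ?if_same //.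
by rewrite mulVf ?expf_neq0.
Qed.

(** [term_shift_l] is applied to each k. Its denominator (q^(l+1) sqrt a; q)_k and the given
    (-q^(l+1) sqrt a; q)_k combine to (a q^(2l+2); q^2)_k, so the sum over k is [watson_shift_m] at
    a q^(2l) and n - i. *)
Lemma phi43_double_sum :
  phi43 n (q ^ (- n%:Z)) (q ^+ (1 + l + n) * a) sc (- (q ^+ m * sc))
        (q * sa) (- (q ^+ (1 + l) * sa)) (q ^+ m * c) q q
  = qpochs [:: q ^+ (1 + l + n) * a; q ^+ (1 + n) * sa] q l
    / qpochs [:: q ^+ (1 + l + 2 * n) * a; q * sa] q l
    * \sum_(i < n.+1) \sum_(j < (n - i).+1) l_coef q a sa l n i * m_coef (a * q ^+ l.*2) (n - i) j.
Proof.
rewrite [q ^+ _ * a]mulrC [q ^+ (1 + n) * _]mulrC [q ^+ (1 + l + 2 * n) * _]mulrC mul2n.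
rewrite [q * sa]mulrC [q ^+ (1 + l) * _]mulrC !add1n !addSn -exprnN.
pose al := a * q ^+ l.*2.
have al0 : al != 0 by rewrite mulf_neq0 ?expf_neq0.
have hal k : 1 - al * q ^+ k != 0 by rewrite -mulrA -exprD.
pose E N k := qpochs [:: (q ^+ N)^-1; al * q ^+ N.+1; sc; - (q ^+ m * sc)] q k
     / (qpoch q q k * qpoch (al * q ^+ 2) (q ^+ 2) k * qpoch (q ^+ m * c) q k) * q ^+ k.
set P := qpochs _ q l / _.
transitivity (P * \sum_(k < n.+1) \sum_(i < n.+1) l_coef q a sa l n i * E (n - i)%N k).
  rewrite /phi43 mulr_sumr; apply: eq_bigr => k _.
  have kn : (k <= n)%N by rewrite -ltnS.
  have := term_shift_l q0 a0 saE ha hai l hn kn; rewrite -/P => L.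
  transitivity (qpochs [:: (q ^+ n)^-1; a * q ^+ (l + n).+1] q k / qpoch (sa * q) q k
    * (qpochs [:: sc; - (q ^+ m * sc)] q k / qpochs [:: q; - (sa * q ^+ l.+1); q ^+ m * c] q k * q ^+ k)).
    by rewrite /qpochs !big_cons !big_nil !mulr1 !invfM; ring.
  rewrite L -mulrA mulr_suml; congr (_ * _); apply: eq_bigr => i _.
  have Ea : qpoch (al * q ^+ 2) (q ^+ 2) k = qpoch (sa * q ^+ l.+1) q k * qpoch (- (sa * q ^+ l.+1)) q k.
    rewrite qpochN exprMn saE -exprM muln2 doubleS; congr (qpoch _ _ _).
    by rewrite -mulrA -exprD addn2.
  rewrite /E Ea /al -[a * _ * _]mulrA -exprD addnS.
  by rewrite /qpochs !big_cons !big_nil !mulr1 !invfM; ring.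
congr (_ * _); rewrite exchange_big /=; apply: eq_bigr => i _.
have ni : (n - i <= n)%N by rewrite leq_subr.
rewrite -!mulr_sumr; congr (_ * _).
rewrite (@sum_ord_trunc _ (n - i) n (E (n - i)%N)) //.
  exact: (watson_shift_m q0 al0 c0 scE hal hc m (qpoch_neq0_le ni hn)).
move=> k /andP[ik kn]; rewrite /E /qpochs !big_cons.
rewrite (@qpoch_eq0 _ _ _ k (n - i)) ?mul0r //.
by rewrite mulVf ?expf_neq0.
Qed.

Lemma T_coef i j : (i + j <= n)%N ->
  T q a c sa sc l m n i j = l_coef q a sa l n i * m_coef (a * q ^+ l.*2) (n - i) j.
Proof.
move=> ijn; rewrite /T ijn /m_coef /chi -signr_odd.
case: ifP => od; first by rewrite expr1 subrr mul0r !mulr0.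
rewrite expr0 -(mulr2n 1) divff // mulr1.
set r := (n - i - j)./2.
have nE : n = (i + j + r.*2)%N.
  by rewrite even_halfK ?od //; lia.
have zneg (e : int) (k : nat) : e = - k%:Z -> q ^ e = (q ^+ k)^-1.
  by move=> ->; rewrite -exprnN.
have zpos (e : int) (k : nat) : e = k%:Z -> q ^ e = q ^+ k by move=> ->.
have C2 : (j * j = 'C(j, 2) + 'C(j, 2) + j)%N.
  by elim: {+}j => [|p IHp] //; rewrite binS bin1; move: IHp; nia.
(* With n - i = j + 2r and j^2 = 2 binom(j, 2) + j the exponent splits into 2i for the
   very-well-poised factor, the power of q in [m_coef], and 2jr from (c q^(2j))^r. *)
have -> : q ^ ((2 * i)%N%:Z + (m%:Z + n%:Z - i%:Z) * j%:Z - 'C(j, 2)%:Z)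
    = q ^+ (i + i) * q ^+ (m * j + 'C(j, 2) + j) * q ^+ ((j + j) * r).
  by rewrite -!exprD; apply: zpos; move: C2; rewrite nE; nia.
rewrite (zpos _ ((l.*2 + n.*2).+1 - (i + i))%N); last by lia.
rewrite (zneg _ l) // (zneg _ n) // (zneg _ (l.*2 + n.*2).+1); last by lia.
rewrite (zneg _ (l + n.*2)%N); last by lia.
rewrite (zneg _ (l.*2 + n)%N); last by lia.
rewrite (zneg _ m) // (zneg _ (n - i)%N); last by lia.
rewrite (zpos _ (l.*2 + (n - i)).+1); last by lia.
have -> : q ^ (j%:Z - 1) * c = c * q ^+ j / q.
  by transitivity (q ^+ j * q^-1 * c); [rewrite expfzDr | ring].
have inva e : (q ^+ e)^-1 / a = (a * q ^+ e)^-1 by rewrite invfM mulrC.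
rewrite !inva ![q ^+ _ * a]mulrC.
have Aq e : a * q ^+ l.*2 * q ^+ e = a * q ^+ (l.*2 + e) by rewrite -mulrA -exprD.
rewrite [q ^+ (1 + 2 * j) * c]mulrC !Aq.
have -> : (1 + 2 * l + 2 * n = (l.*2 + n.*2).+1)%N by lia.
have -> : (2 + 2 * l = l.*2 + 2)%N by lia.
have -> : (l.*2 + 2 + 2 * j = l.*2 + (j + j).+2)%N by lia.
have -> : (1 + 2 * j = (j + j).+1)%N by lia.
have -> : (n - i = j + r.*2)%N by lia.
rewrite [(l.*2 + (j + r.*2).+1)%N]addnS exprMn -[(q ^+ (j + j)) ^+ r]exprM [sc ^+ (_ + _)]exprD.
have -> : sc ^+ r.*2 = c ^+ r by rewrite -mul2n exprM scE.
have D2 : qpoch (a * q ^+ (l.*2 + 2)) (q ^+ 2) j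
   = qpoch (q ^+ (1 + l) * sa) q j * qpoch (- (q ^+ (1 + l) * sa)) q j.
  rewrite qpochN exprMn saE -exprM mulrC; congr (qpoch (_ ^+ _ * _) _ _); lia.
rewrite D2 /l_coef; set X := q ^+ (l.*2 + n.*2).+1.
(* The power q^(2i) rewrites the factor of [T] as the very-well-poised factor for A = 1/(a X). *)
have V : q ^+ (i + i) * ((1 - a * q ^+ ((l.*2 + n.*2).+1 - (i + i))) / (1 - a * X))
    = (1 - (a * X)^-1 * q ^+ (i + i)) / (1 - (a * X)^-1).
  have XE : X = q ^+ ((l.*2 + n.*2).+1 - (i + i)) * q ^+ (i + i).
    by rewrite -exprD subnK //; lia.
  have X0 : X != 0 by rewrite expf_neq0.
  have h : 1 - a * X != 0 by exact: ha.
  have -> : (1 - (a * X)^-1) = (a * X - 1) / (a * X) by field; rewrite a0 X0.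
  have h' : a * X - 1 != 0 by rewrite -opprB oppr_eq0.
  move: X0 h h'; rewrite XE; move: (q ^+ (i + i)) (q ^+ (_ - _)) => y w X0 h h'.
  have := X0; rewrite mulf_eq0 negb_or => /andP[w0 y0].
  by field; rewrite h a0 w0 y0 h'.
rewrite -V /qpochs !big_cons !big_nil !mulr1 !invfM.
by ring.
Qed.

(** The triangle i + j <= n and the rectangle i <= l, j <= m are compared inside a larger rectangle:
    terms outside the triangle are 0 by convention, those outside the rectangle by (q^-l; q)_i and
    (q^-m; q)_j. *)
Lemma generic_identity :
  phi43 n (q ^ (- n%:Z)) (q ^+ (1 + l + n) * a) sc (- (q ^+ m * sc))
        (q * sa) (- (q ^+ (1 + l) * sa)) (q ^+ m * c) q q
  = qpochs [:: q ^+ (1 + l + n) * a; q ^+ (1 + n) * sa] q l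
    / qpochs [:: q ^+ (1 + l + 2 * n) * a; q * sa] q l
    * \sum_(i < l.+1) \sum_(j < m.+1) T q a c sa sc l m n i j.
Proof.
rewrite phi43_double_sum; congr (_ * _).
pose t i j := if (i + j <= n)%N then l_coef q a sa l n i * m_coef (a * q ^+ l.*2) (n - i) j else 0.
have tT i j : T q a c sa sc l m n i j = t i j.
  by rewrite /t; case: ifP => ijn; [exact: T_coef | rewrite /T ijn].
have t0 i j : (n < i + j)%N -> t i j = 0 by rewrite /t ltnNge => /negbTE->.
have tl i j : (l < i)%N -> t i j = 0 by move=> li; rewrite /t l_coef0 // mul0r if_same.
have tm i j : (m < j)%N -> t i j = 0 by move=> mj; rewrite /t m_coef0 // mulr0 if_same.
transitivity (\sum_(i < (n + l).+1) \sum_(j < (n + m).+1) t i j).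
  rewrite [RHS](@sum_ord_trunc _ n _ (fun i => \sum_(j < (n + m).+1) t i j)) ?leq_addr //.
    apply: eq_bigr => i _.
    have ni : (i <= n)%N by rewrite -ltnS.
    rewrite (@sum_ord_trunc _ (n - i) _ (t i)); first last.
    - by move=> j /andP[ij _]; apply: t0; lia.
    - by lia.
    by apply: eq_bigr => j _; rewrite /t; have := ltn_ord j; case: ifP => //; lia.
  by move=> i /andP[ni _]; apply: big1 => j _; apply: t0; lia.
rewrite (@sum_ord_trunc _ l _ (fun i => \sum_(j < (n + m).+1) t i j)) ?leq_addl //; last first.
  by move=> i /andP[li _]; apply: big1 => j _; apply: tl.
apply: eq_bigr => i _; rewrite (@sum_ord_trunc _ m _ (t i)) ?leq_addl //.
  by apply: eq_bigr => j _; rewrite tT.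
by move=> j /andP[mj _]; apply: tm.
Qed.

End Generic.

(** * Evaluation of rational functions at X = 0 *)

Section Specialization.
Variable F : fieldType.
Local Notation K := {fraction {poly F}}.
Local Notation "p %:F" := (@FracField.tofrac _ p).

(** Says that x lies in the local ring of F[X] at 0 and has residue v. As a relation it accepts any
    fraction representing x with denominator nonzero at 0, without reduced forms. *)
Definition value_at0 (x : K) (v : F) :=
  exists p d : {poly F}, [/\ d.[0] != 0, x * d%:F = p%:F & v = p.[0] / d.[0]].

Lemma value_at0_unique x v w : value_at0 x v -> value_at0 x w -> v = w.
Proof.
move=> [p [d [d0 xd ->]]] [p' [d' [d'0 xd' ->]]].
apply/eqP; rewrite eqr_div // -!hornerM; apply/eqP; congr (horner _ 0).
by apply/eqP; rewrite -tofrac_eq !tofracM -xd -xd'; apply/eqP; ring.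
Qed.

Lemma value_at0_poly p : value_at0 p%:F p.[0].
Proof. by exists p, 1; rewrite hornerC oner_neq0 tofrac1 mulr1 divr1. Qed.

Lemma value_at0_const u : value_at0 u%:P%:F u.
Proof. by have := value_at0_poly u%:P; rewrite hornerC. Qed.

Lemma value_at0_1 : value_at0 1 1.
Proof. by have := value_at0_const 1; rewrite tofrac1. Qed.

Lemma value_at0_0 : value_at0 0 0.
Proof. by have := value_at0_const 0; rewrite tofrac0. Qed.

Lemma value_at0D x y v w : value_at0 x v -> value_at0 y w -> value_at0 (x + y) (v + w).
Proof.
move=> [p [d [d0 xd ->]]] [p' [d' [d'0 xd' ->]]].
exists (p * d' + p' * d), (d * d'); split.
- by rewrite hornerM mulf_neq0.
- by rewrite tofracD !tofracM -xd -xd'; ring.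
- by rewrite hornerD !hornerM; field; rewrite d0 d'0.
Qed.

Lemma value_at0M x y v w : value_at0 x v -> value_at0 y w -> value_at0 (x * y) (v * w).
Proof.
move=> [p [d [d0 xd ->]]] [p' [d' [d'0 xd' ->]]].
exists (p * p'), (d * d'); split.
- by rewrite hornerM mulf_neq0.
- by rewrite !tofracM -xd -xd'; ring.
- by rewrite !hornerM; field; rewrite d0 d'0.
Qed.

Lemma value_at0N x v : value_at0 x v -> value_at0 (- x) (- v).
Proof.
move=> [p [d [d0 xd ->]]]; exists (- p), d; split=> //.
- by rewrite tofracN -xd mulNr.
- by rewrite hornerN mulNr.
Qed.

Lemma value_at0_neq0 x v : value_at0 x v -> v != 0 -> x != 0.
Proof.
move=> xv; apply: contraNneq => x0; apply/eqP/(value_at0_unique xv).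
by rewrite x0; exact: value_at0_0.
Qed.

Lemma value_at0V x v : value_at0 x v -> v != 0 -> value_at0 x^-1 v^-1.
Proof.
move=> xv v0; have x0 := value_at0_neq0 xv v0.
move: xv v0 => [p [d [d0 xd ->]]]; rewrite mulf_eq0 invr_eq0 negb_or => /andP[p0 _].
exists d, p; split=> //; first by rewrite -xd mulKf.
by rewrite invf_div.
Qed.

Lemma value_at0X x v k : value_at0 x v -> value_at0 (x ^+ k) (v ^+ k).
Proof.
move=> xv; elim: k => [|k IHk]; first exact: value_at0_1.
by rewrite !exprS; apply: value_at0M.
Qed.

Lemma value_at0Xz x v (z : int) : value_at0 x v -> v != 0 -> value_at0 (x ^ z) (v ^ z).
Proof.
move=> xv v0; case: z => k; first exact: value_at0X.
by apply: value_at0V; [exact: value_at0X | rewrite expf_neq0].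
Qed.

Lemma value_at0_sum k (f : 'I_k -> K) (g : 'I_k -> F) :
  (forall i, value_at0 (f i) (g i)) -> value_at0 (\sum_i f i) (\sum_i g i).
Proof.
by move=> fg; elim/big_ind2: _ => // *; [exact: value_at0_0 | exact: value_at0D].
Qed.

Lemma value_at0_qpoch x v y w k :
  value_at0 x v -> value_at0 y w -> value_at0 (qpoch x y k) (qpoch v w k).
Proof.
move=> xv yw; rewrite /qpoch; elim/big_ind2: _ => [||i _].
- exact: value_at0_1.
- by move=> *; exact: value_at0M.
apply: value_at0D; first exact: value_at0_1.
by apply/value_at0N/value_at0M => //; exact: value_at0X.
Qed.

Lemma value_at0_qpochs_nil y w k :
  value_at0 (qpochs [::] y k) (qpochs [::] w k).
Proof. by rewrite /qpochs !big_nil; exact: value_at0_1. Qed.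

Lemma value_at0_qpochs_cons x v xs vs y w k :
  value_at0 x v -> value_at0 y w -> value_at0 (qpochs xs y k) (qpochs vs w k) ->
  value_at0 (qpochs (x :: xs) y k) (qpochs (v :: vs) w k).
Proof.
by move=> xv yw h; rewrite /qpochs !big_cons; apply: value_at0M => //; exact: value_at0_qpoch.
Qed.

(** Descends through an expression; each inverse leaves the goal that its value in F is nonzero,
    which is where the denominator hypotheses enter. *)
Ltac value_step := lazymatch goal with
  | |- value_at0 1 _ => exact: value_at0_1
  | |- value_at0 (_ + _) _ => apply: value_at0D
  | |- value_at0 (_ * _) _ => apply: value_at0M
  | |- value_at0 (- _) _ => apply: value_at0N
  | |- value_at0 (_^-1) _ => apply: value_at0V
  | |- value_at0 (_ ^+ _) _ => apply: value_at0X
  | |- value_at0 (_ ^ _) _ => apply: value_at0Xz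
  | |- value_at0 (qpochs [::] _ _) _ => exact: value_at0_qpochs_nil
  | |- value_at0 (qpochs _ _ _) _ => apply: value_at0_qpochs_cons
  end.

(** The polynomial u (X + s)^2 has degree 2, hence is not 1. *)
Lemma one_sub_sqr_neq0 s u : u != 0 -> 1 - ('X + s%:P)%:F ^+ 2 * u%:P%:F != 0 :> K.
Proof.
move=> u0; rewrite -tofracXn -tofracM -tofrac1 -tofracB tofrac_eq0 subr_eq0.
apply/eqP => /(congr1 (size : {poly F} -> nat)).
by rewrite size_poly1 mulrC mul_polyC size_scale // -[s]opprK polyCN size_exp_XsubC.
Qed.

Lemma Xadd_neq0 s : ('X + s%:P)%:F != 0 :> K.
Proof. by rewrite tofrac_eq0 -size_poly_eq0 size_XaddC. Qed.

Variables (q a c sa sc : F) (l m n : nat).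
Hypotheses (two0 : (2 : F) != 0) (q0 : q != 0) (a0 : a != 0) (c0 : c != 0).
Hypotheses (saE : sa ^+ 2 = a) (scE : sc ^+ 2 = c).
Hypothesis phi_den : forall k : nat, (k <= n)%N ->
     qpochs [:: q; q * sa; - (q ^+ (1 + l) * sa); q ^+ m * c] q k != 0.
Hypothesis pref_den : qpochs [:: q ^+ (1 + l + 2 * n) * a; q * sa] q l != 0.
Hypothesis T_den_neq0 : forall i j : nat, (i <= l)%N -> (j <= m)%N ->
     (i + j <= n)%N -> ~~ odd (n - i - j) -> T_den q a c sa l m n i j != 0.

Lemma specialized_identity :
  phi43 n (q ^ (- n%:Z)) (q ^+ (1 + l + n) * a) sc (- (q ^+ m * sc))
        (q * sa) (- (q ^+ (1 + l) * sa)) (q ^+ m * c) q q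
  = qpochs [:: q ^+ (1 + l + n) * a; q ^+ (1 + n) * sa] q l
    / qpochs [:: q ^+ (1 + l + 2 * n) * a; q * sa] q l
    * \sum_(i < l.+1) \sum_(j < m.+1) T q a c sa sc l m n i j.
Proof.
pose Q : K := q%:P%:F; pose SA : K := ('X + sa%:P)%:F; pose SC : K := ('X + sc%:P)%:F.
have vQ : value_at0 Q q by exact: value_at0_const.
have vX s : value_at0 ('X + s%:P)%:F s.
  by have := value_at0_poly ('X + s%:P); rewrite hornerD hornerX hornerC add0r.
have vSA : value_at0 SA sa by exact: vX.
have vSC : value_at0 SC sc by exact: vX.
have vA : value_at0 (SA ^+ 2) a by rewrite -saE; exact: value_at0X.
have vC : value_at0 (SC ^+ 2) c by rewrite -scE; exact: value_at0X.
have v2 : value_at0 2 2 by apply: value_at0D; exact: value_at0_1.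
(* Quotients of powers of q cover all genericity conditions: those on a, on its inverse and on
   c/q. *)
have nz s k k' : 1 - ('X + s%:P)%:F ^+ 2 * (Q ^+ k / Q ^+ k') != 0 :> K.
  have -> : Q ^+ k / Q ^+ k' = (q ^+ k / q ^+ k')%:P%:F.
    have h : Q ^+ k' != 0 by rewrite expf_neq0 // (value_at0_neq0 vQ).
    apply: (mulIf h); rewrite divfK // /Q -!tofracXn -tofracM -!rmorphXn -rmorphM /=.
    by rewrite divfK ?expf_neq0.
  by apply: one_sub_sqr_neq0; rewrite mulf_neq0 ?invr_neq0 ?expf_neq0.
have nzA k k' : 1 - SA ^+ 2 * (Q ^+ k / Q ^+ k') != 0 := nz sa k k'.
have nzC k k' : 1 - SC ^+ 2 * (Q ^+ k / Q ^+ k') != 0 := nz sc k k'.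
have SA0 : SA ^+ 2 != 0 by apply: expf_neq0; exact: Xadd_neq0.
have SC0 : SC ^+ 2 != 0 by apply: expf_neq0; exact: Xadd_neq0.
clearbody Q SA SC; clear nz vX.
have Q0 : Q != 0 := value_at0_neq0 vQ q0.
have hn : qpoch Q Q n != 0.
  apply: value_at0_neq0 (value_at0_qpoch n vQ vQ) _.
  by move: (phi_den (leqnn n)); rewrite /qpochs big_cons mulf_eq0 negb_or => /andP[].
have hA k : 1 - SA ^+ 2 * Q ^+ k != 0 by have := nzA k 0; rewrite expr0 divr1.
have hAi e k : 1 - (SA ^+ 2 * Q ^+ e)^-1 * Q ^+ k != 0.
  (* If this factor vanished, then Q^k = SA^2 Q^e and so 1 - SA^2 Q^e / Q^k = 0. *)
  have := nzA e k; apply: contraNneq => h.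
  have X0 : SA ^+ 2 * Q ^+ e != 0 := mulf_neq0 SA0 (expf_neq0 e Q0).
  move/eqP: h; rewrite subr_eq0 => /eqP h.
  have -> : Q ^+ k = SA ^+ 2 * Q ^+ e by apply: (mulfI (invr_neq0 X0)); rewrite -h mulVf.
  by rewrite mulrA divff // subrr.
have hC k : 1 - SC ^+ 2 / Q * Q ^+ k != 0.
  by have := nzC k 1; rewrite mulrA mulrAC expr1.
have := generic_identity l m (value_at0_neq0 v2 two0) Q0 SA0 SC0 (erefl _) (erefl _) hn hA hAi hC.
set lhs := phi43 _ _ _ _ _ _ _ _ _ _; set rhs := (X in lhs = X) => E.
(* The left side over F(X) has the left side over F as its value; by [E] the right side over F is
   also its value. *)
apply: (@value_at0_unique lhs).
  rewrite /lhs /phi43; apply: value_at0_sum => k.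
  repeat first [assumption | value_step].
  by apply: phi_den; rewrite -ltnS.
rewrite E /rhs; apply: value_at0M.
  repeat first [assumption | value_step].
apply: value_at0_sum => i; apply: value_at0_sum => j.
rewrite /T; case: ifP => ijn; last exact: value_at0_0.
(* The hypothesis on [T_den] concerns even n - i - j; in the odd case [chi] makes the term 0 over
   both fields. *)
case od: (odd (n - i - j)).
  have chi0 (G : fieldType) : chi G (n - i - j) = 0.
    by rewrite /chi -signr_odd od expr1 subrr mul0r.
  by rewrite (chi0 K) (chi0 F) [X in value_at0 X]mulr0 [X in value_at0 _ X]mulr0; exact: value_at0_0.
have il : (i <= l)%N by rewrite -ltnS.
have jm : (j <= m)%N by rewrite -ltnS.
have := T_den_neq0 il jm ijn (negbT od); rewrite /T_den !mulf_eq0 !negb_or.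
move=> /andP[/andP[/andP[d1 d2] d3] d4].
have sa0 : sa != 0 by apply: contraNneq a0 => h; rewrite -saE h expr0n.
rewrite /chi; repeat first [assumption | value_step].
by rewrite expf_neq0.
Qed.
End Specialization.

(** * The identity over the complex numbers *)

Theorem mainTheorem1 (R : realType) (q a c sa sc : R[i]) (l m n : nat)
  (q_neq0 : q != 0) (a_neq0 : a != 0) (c_neq0 : c != 0)
  (sqrt_a : sa ^+ 2 = a) (sqrt_c : sc ^+ 2 = c)
  (phi_den : forall k : nat, (k <= n)%N ->
     qpochs [:: q; q * sa; - (q ^+ (1 + l) * sa); q ^+ m * c] q k != 0)
  (pref_den : qpochs [:: q ^+ (1 + l + 2 * n) * a; q * sa] q l != 0)
  (T_den_neq0 : forall i j : nat, (i <= l)%N -> (j <= m)%N ->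
     (i + j <= n)%N -> ~~ odd (n - i - j) -> T_den q a c sa l m n i j != 0) :
  phi43 n (q ^ (- n%:Z)) (q ^+ (1 + l + n) * a) sc (- (q ^+ m * sc))
        (q * sa) (- (q ^+ (1 + l) * sa)) (q ^+ m * c) q q
  = qpochs [:: q ^+ (1 + l + n) * a; q ^+ (1 + n) * sa] q l
    / qpochs [:: q ^+ (1 + l + 2 * n) * a; q * sa] q l
    * \sum_(i < l.+1) \sum_(j < m.+1) T q a c sa sc l m n i j.
Proof.
by apply: specialized_identity => //; rewrite Num.Theory.pnatr_eq0.
Qed.
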